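(* Let $G$ be a graph and let $a$ and $b$ be two positive integers with $ab|V(G)|$ even and $a<b\le\frac15(6a+1)$. If $G$ is $\max\{2b,64(b-a)^2\}$-tough and $|V(G)|\ge b+1$, then $G$ admits a connected $\{a,b\}$-factor.
   Context: Graphs are finite, have no loops, and may have multiple edges. An $\{a,b\}$-factor of $G$ is a spanning subgraph all of whose vertex degrees lie in $\{a,b\}$. For a positive real $t$, $G$ is $t$-tough if $\omega(G\setminus S)\le\max\{1,\frac1t|S|\}$ for all $S\subseteq V(G)$, where $\omega$ denotes the number of components and $G\setminus S$ is obtained by deleting the vertices of $S$. *)

(* Defs.v *)
From mathcomp Require Import all_boot all_order all_algebra.
From mathcomp Require Import reals.

Set Implicit Arguments.
Unset Strict Implicit.
Unset Printing Implicit Defensive.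

Import Order.TTheory GRing.Theory Num.Theory.

(* Edges form a type of their own, so distinct edges may have the same ends;
   the cardinality condition excludes loops. *)
Record multigraph := Multigraph {
  vertex : finType;
  edge : finType;
  ends : edge -> {set vertex};
  card_ends : forall e, #|ends e| = 2 }.

Section Multigraph.
Variable G : multigraph.
Implicit Types (U S : {set vertex G}) (F : {set edge G}).

(* In adj and omega, the pair U, F stands for the subgraph with vertex set U
   whose edges are the members of F with both ends in U. *)
Definition adj U F : rel (vertex G) :=
  fun u v => [&& u \in U, v \in U & [exists e in F, ends e == [set u; v]]].

Definition omega U F : nat := n_comp (adj U F) U.

(* n_comp counts components only for a closed set and a symmetric connect;
   connect_adj_sym and closed_adj verify both conditions. *)
Lemma adj_sym U F : symmetric (adj U F).
Proof. by move=> u v; rewrite /adj setUC andbCA. Qed.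

Lemma connect_adj_sym U F : connect_sym (adj U F).
Proof. exact/sym_connect_sym/adj_sym. Qed.

Lemma closed_adj U F : closed (adj U F) U.
Proof. by move=> u v /and3P[-> ->]. Qed.

(* Meant for 0 < t. *)
Definition tough (R : realType) (t : R) : Prop :=
  forall S, ((omega (~: S) setT)%:R <= Num.max 1 (t^-1 * #|S|%:R))%R.

Definition degree F (v : vertex G) : nat := #|[set e in F | v \in ends e]|.

(* A spanning subgraph is identified with its edge set. *)
Definition is_factor (a b : nat) F : Prop :=
  forall v, degree F v = a \/ degree F v = b.

Definition connected_factor F : Prop := omega setT F = 1.

End Multigraph.

(* Main.v *)
(** Put k = b - a, so that 5k <= a + 1.  One of a|V|, b|V| is even; call c the
    corresponding degree.  If the underlying simple graph is complete, a circulant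
    graph is a connected c-factor.  Otherwise toughness makes |V| and all degrees large.

    A local search in the spirit of Win and of Fürer-Raghavachari, run in the
    matroid of m-sparse edge sets (at most m(|U| - 1) edges inside every U), gives
    m(|V| - 1) edges of maximum degree at most 2m + 1; by Nash-Williams they split
    into m edge-disjoint spanning trees.

    If k = 1, one spanning tree X is kept, and the remaining demand g = b - deg X is
    met half-integrally: a {0, 1/2, 1}-weighting of the other edges with degrees g is
    a degree-constrained subgraph of the bipartite double cover, and the Ore-Hall
    condition follows from toughness applied to independent sets.  The edges of
    weight 1/2 have even degrees; alternating along closed trails rounds them with an
    error of at most one at each vertex, which yields degrees b and b - 1.

    If k >= 2 then a >= 9, and three trees are taken.  The first is kept; the second,
    completed by a join inside the third to an even connected subgraph K, receives
    weight 1/2.  Now the edges of weight 1/2 form a connected even graph with an even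
    number of edges, and alternating along an Euler tour rounds them without error. *)

(* Prescribing degrees in a general graph meets parity obstructions; on the bipartite double cover
   only a Hall condition is left, and parity returns solely when the edges of weight 1/2 are
   rounded. An error of one there is harmless if b - 1 = a. For larger k it has to be avoided, and
   this is what the two additional trees pay for: alternation along a single tour is exact once its
   length is even, which follows from the parity of c|V|.

   The trees use up degree. With L = 2m + 1, that is 3 for one tree and 7 for three, the Hall
   condition follows from c^2 + L <= (c - L)t, which needs c > L. The inequality 5b <= 6a + 1 gives
   a >= 4 always and a >= 9 for k >= 2; hence c - L >= 2 in both cases. For small c the inequality
   comes from t >= 64k^2, read as 64 or 256; for large c it comes from t >= 2b.

   The search runs over m-sparse sets, not over single trees, because the degree bound is needed for
   the union of the trees. *)
Require Import Defs.
From mathcomp Require Import all_boot all_order all_algebra.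
From mathcomp Require Import reals.
From mathcomp Require Import zify.

Set Implicit Arguments.
Unset Strict Implicit.
Unset Printing Implicit Defensive.

Import Order.TTheory GRing.Theory Num.Theory.

(* [lia] compares atoms syntactically, so cardinals are first abstracted up to
   conversion; hypotheses not about naturals are dropped for speed. *)
Ltac card_lia :=
  repeat match goal with
  | H : is_true (leq _ _) |- _ => revert H
  | H : @eq (Equality.sort _) _ _ |- _ => revert H
  | H : @eq nat _ _ |- _ => revert H
  | H : @eq bool (eq_op _ _) _ |- _ => revert H end;
  repeat match goal with H : is_true _ |- _ => clear H end;
  repeat match goal with |- context [@card.body ?T ?A] =>
    let n := fresh "n" in set n := (@card.body T A); clearbody n end;
  intros; lia.

(** * Connectivity and forests *)

Section SimpleGraphs.
Variable V : finType.
Implicit Types (x y u v w : V) (S U P Q W : {set V}) (e f : {set V}).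
Implicit Types (E F X Y : {set {set V}}).

Definition simple E := forall e, e \in E -> #|e| = 2.

Definition deg F v := #|[set e in F | v \in e]|.

Definition conn F : rel V := connect (fun u v => [set u; v] \in F).

Definition spans F := forall u v, conn F u v.

Definition inside F U := [set e in F | e \subset U].

Lemma simpleS E F : F \subset E -> simple E -> simple F.
Proof. by move=> sFE hE e /(subsetP sFE) /hE. Qed.

Lemma simple_neq E u v : simple E -> [set u; v] \in E -> u != v.
Proof. by move=> hE /hE; rewrite cards2; case: (u == v). Qed.

Lemma simple_ends E e : simple E -> e \in E -> exists u v, u != v /\ e = [set u; v].
Proof. by move=> hE /hE /eqP/cards2P[u [v [uv ->]]]; exists u, v. Qed.

Lemma simple_endsx E e v : simple E -> e \in E -> v \in e ->
  exists2 u, u != v & e = [set v; u].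
Proof.
move=> hE eE ve; have [x [y [xy De]]] := simple_ends hE eE.
move: ve; rewrite De !inE => /orP[] /eqP->.
  by exists y; rewrite // eq_sym.
by exists x => //; rewrite setUC.
Qed.

Lemma set2_inj u v w : u != v -> [set u; v] = [set u; w] -> v = w.
Proof.
move=> uv /setP/(_ v); rewrite !inE eqxx orbT eq_sym (negbTE uv) /=.
by move/esym/eqP.
Qed.

Lemma set2_subset u v U : ([set u; v] \subset U) = (u \in U) && (v \in U).
Proof. by rewrite subUset !sub1set. Qed.

Lemma conn_refl F u : conn F u u. Proof. exact: connect0. Qed.

Lemma conn_sym F u v : conn F u v = conn F v u.
Proof. by apply: sym_connect_sym => x y; rewrite setUC. Qed.

Lemma conn_trans F u v w : conn F u v -> conn F v w -> conn F u w.
Proof. exact: connect_trans. Qed.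

Lemma conn1 F u v : [set u; v] \in F -> conn F u v.
Proof. by move=> h; apply: connect1. Qed.

Lemma conn_sub F (r : rel V) : reflexive r -> transitive r ->
  (forall u v, [set u; v] \in F -> r u v) -> forall u v, conn F u v -> r u v.
Proof.
move=> rr tr hF u v /connectP[p]; elim: p u => [|w p IHp] u /= => [_ -> //|].
by case/andP=> /hF ruw /IHp pw /pw; apply: tr.
Qed.

Lemma connW E F u v : F \subset E -> conn F u v -> conn E u v.
Proof.
move=> sFE; apply: conn_sub; [exact: conn_refl| |].
  by move=> ? ? ?; apply: conn_trans.
by move=> x y /(subsetP sFE)/conn1.
Qed.

Lemma conn_invariant F (T : eqType) (c : V -> T) u v :
  (forall x y, [set x; y] \in F -> c x = c y) -> conn F u v -> c u = c v.
Proof.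
move=> h /(@conn_sub F (fun x y => c x == c y)) H; apply/eqP/H => //.
  by move=> y x z /eqP-> .
by move=> x y /h->.
Qed.

Lemma set2_eq u w p q : [set u; w] = [set p; q] ->
  (u = p /\ w = q) \/ (u = q /\ w = p).
Proof.
move=> H; have Hu : u \in [set p; q] by rewrite -H set21.
have Hw : w \in [set p; q] by rewrite -H set22.
have Hp : p \in [set u; w] by rewrite H set21.
have Hq : q \in [set u; w] by rewrite H set22.
move: Hu Hw Hp Hq; rewrite !inE.
case/orP=> /eqP-> /orP[]/eqP->; try by [left|right].
  by rewrite !orbb => _ /eqP->; left.
by rewrite !orbb => /eqP->; left.
Qed.

Lemma conn_setU1 F e u v p q : e = [set p; q] -> conn (e |: F) u v ->
  conn F u v \/ (conn F u p /\ conn F q v) \/ (conn F u q /\ conn F p v).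
Proof.
move=> -> /connectP[s]; elim: s u => [|w s IHs] u /=.
  by move=> _ ->; left; apply: conn_refl.
case/andP=> uw ps lv; have {IHs ps lv} H := IHs w ps lv.
move: uw; rewrite in_setU1 => /orP[/eqP/set2_eq uw|/conn1 uw]; last first.
  case: H => [H|[[H H']|[H H']]]; [left|right; left|right; right].
  - exact: conn_trans uw H.
  - by split=> //; apply: conn_trans uw H.
  - by split=> //; apply: conn_trans uw H.
case: uw => [[? ?]|[? ?]]; subst.
  case: H => [H|[[_ H]|[_ H]]]; [right; left|right; left|left] => //.
    by split=> //; apply: conn_refl.
  by split=> //; apply: conn_refl.
case: H => [H|[[_ H]|[_ H]]]; [right; right|left|right; right] => //.
  by split=> //; apply: conn_refl.
by split=> //; apply: conn_refl.
Qed.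

Lemma conn_cut F f u v : simple F -> f \in F -> conn F u v -> ~~ conn (F :\ f) u v ->
  exists p q, f = [set p; q] /\ conn (F :\ f) u p /\ conn (F :\ f) q v.
Proof.
move=> sF fF cuv nuv; have [p [q [_ Df]]] := simple_ends sF fF.
move: cuv; rewrite -{1}(setD1K fF) => /(conn_setU1 Df)[H|[H|H]].
- by rewrite H in nuv.
- by exists p, q.
- by exists q, p; rewrite setUC.
Qed.

(** Since [f] separates [u] from [v] in [F], its ends lie on the two sides, and [e] joins these
    sides again. In a forest, [f] is an edge of the cycle closed by [e]. *)
Lemma conn_exchange F e f u v : simple F -> e = [set u; v] -> f \in F ->
  conn F u v -> ~~ conn (F :\ f) u v ->
  forall x y, conn (e |: (F :\ f)) x y = conn F x y.
Proof.
move=> sF De fF cuv nuv x y; have [p [q [Df [up qv]]]] := conn_cut sF fF cuv nuv.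
apply/idP/idP.
  apply: (conn_sub (r := conn F)) => [z|z w t|z w]; [exact: conn_refl|exact: conn_trans|].
  rewrite in_setU1 => /orP[/eqP|]; last by rewrite in_setD1 => /andP[_ /conn1].
  rewrite De => /set2_eq[[-> ->]|[-> ->]] //; by rewrite conn_sym.
have sub z w : conn (F :\ f) z w -> conn (e |: (F :\ f)) z w.
  by apply: connW; apply: subsetUr.
have cpq : conn (e |: (F :\ f)) p q.
  apply: (conn_trans (v := u)); first by rewrite conn_sym; apply: sub.
  apply: (conn_trans (v := v)); last by rewrite conn_sym; apply: sub.
  by apply: conn1; rewrite De setU11.
apply: (conn_sub (r := conn (e |: (F :\ f)))) => [z|z w t|z w zwF];
  [exact: conn_refl|exact: conn_trans|].
have [zwf|zwf] := eqVneq [set z; w] f.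
  by case: (set2_eq (etrans zwf Df)) => [[-> ->]|[-> ->]] //; rewrite conn_sym.
by apply/sub/conn1; rewrite in_setD1 zwf.
Qed.


Definition conn_class F v := [set w | conn F v w].
Definition nclasses F := #|[set conn_class F v | v : V]|.

Lemma conn_class_eq F u v : (conn_class F u == conn_class F v) = conn F u v.
Proof.
apply/eqP/idP => [/setP/(_ v)|cuv]; first by rewrite !inE conn_refl.
apply/setP=> w; rewrite !inE; apply/idP/idP; last exact: conn_trans.
by apply: conn_trans; rewrite conn_sym.
Qed.

Lemma nclasses_spans F : nclasses F <= 1 -> spans F.
Proof.
move=> h u v; rewrite -conn_class_eq; apply/eqP.
by apply: (card_le1_eqP h); apply: imset_f.
Qed.

Lemma nclasses0 : nclasses set0 = #|V|.
Proof.
rewrite /nclasses card_imset // => u v /eqP; rewrite conn_class_eq => c.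
by apply/eqP; apply: (conn_sub _ _ _ c) => // [? ? ? /eqP-> //|x y]; rewrite inE.
Qed.

(** Only [x] and [y] may share an image, so [h] is injective once [x] is removed. Adding an edge
    merges two components in this way. *)
Lemma card_imset_collapse (T1 T2 : finType) (h : T1 -> T2) (A : {set T1}) (x y : T1) :
  x \in A -> y \in A -> (forall z t, z \in A -> t \in A -> h z = h t ->
    z = t \/ (z = x \/ z = y) /\ (t = x \/ t = y)) ->
  #|A| <= #|h @: A| + 1.
Proof.
move=> xA yA hh; rewrite (cardsD1 x) xA addnC leq_add2r.
rewrite -(card_in_imset (f := h) (D := A :\ x));
  first by apply/subset_leq_card/imsetS/subsetDl.
move=> z t; rewrite !inE => /andP[zx zA] /andP[tx tA] /(hh _ _ zA tA)[//|].
by case=> [[/eqP|]] ; rewrite ?(negbTE zx) // => -> [/eqP|->] //; rewrite (negbTE tx).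
Qed.

Lemma nclasses_setU1 F e : simple (e |: F) -> nclasses F <= nclasses (e |: F) + 1.
Proof.
move=> sF; have [p [q [pq De]]] := simple_ends sF (setU11 e F).
pose h (A : {set V}) := \bigcup_(v in A) conn_class (e |: F) v.
have hE v : h (conn_class F v) = conn_class (e |: F) v.
  apply/setP=> w; apply/bigcupP/idP => [[u]|]; last by exists v; rewrite // inE conn_refl.
  rewrite !inE => /(connW (subsetUr [set e] F)); exact: conn_trans.
have ->: nclasses (e |: F) = #|h @: [set conn_class F v | v : V]|.
  rewrite -imset_comp /nclasses; congr #|pred_of_set _|.
  by apply: eq_imset => v; rewrite /= hE.
apply: (@card_imset_collapse _ _ _ _ (conn_class F p) (conn_class F q)); try exact: imset_f.
move=> _ _ /imsetP[u _ ->] /imsetP[v _ ->]; rewrite !hE => /eqP; rewrite conn_class_eq.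
case/(conn_setU1 De) => [H|[[H1 H2]|[H1 H2]]]; first by left; apply/eqP;
  rewrite conn_class_eq.
  by right; split; [left|right]; apply/eqP; rewrite conn_class_eq // conn_sym.
by right; split; [right|left]; apply/eqP; rewrite conn_class_eq // conn_sym.
Qed.

Lemma nclasses_merge F p q : ~~ conn F p q -> nclasses ([set p; q] |: F) < nclasses F.
Proof.
move=> npq; set e := [set p; q].
pose h (A : {set V}) := \bigcup_(v in A) conn_class (e |: F) v.
have hE v : h (conn_class F v) = conn_class (e |: F) v.
  apply/setP=> w; apply/bigcupP/idP => [[u]|]; last by exists v; rewrite // inE conn_refl.
  rewrite !inE => /(connW (subsetUr [set e] F)); exact: conn_trans.
have ->: nclasses (e |: F) = #|h @: [set conn_class F v | v : V]|.
  rewrite -imset_comp /nclasses; congr #|pred_of_set _|.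
  by apply: eq_imset => v; rewrite /= hE.
rewrite /nclasses ltn_neqAle leq_imset_card andbT; apply/negP => /imset_injP inj.
have /eqP : conn_class F p = conn_class F q.
  apply: inj; rewrite ?imset_f // !hE; apply/eqP; rewrite conn_class_eq conn1 // setU11 //.
by rewrite conn_class_eq (negbTE npq).
Qed.

Lemma nclasses_lb F : simple F -> #|V| <= nclasses F + #|F|.
Proof.
have [n] := ubnP #|F|; elim: n F => // n IH F; rewrite ltnS => hn sF.
have [->|[e eF]] := set_0Vmem F; first by rewrite nclasses0 cards0 addn0.
have cF : #|F| = (#|F :\ e|).+1 by rewrite (cardsD1 e) eF.
have sD : simple (F :\ e) by apply: simpleS sF; apply: subsetDl.
have := nclasses_setU1 (F := F :\ e) (e := e); rewrite setD1K // => /(_ sF).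
have := IH (F :\ e); rewrite cF in hn * => /(_ hn sD).
lia.
Qed.

(** Acyclicity in the form that every edge is a bridge, so that cycles need no representation. *)
Definition forest F := forall u v, [set u; v] \in F -> ~~ conn (F :\ [set u; v]) u v.

Lemma forestS F F' : F' \subset F -> forest F -> forest F'.
Proof.
move=> sF hF u v /(subsetP sF)/hF; apply: contra; apply: connW.
exact: setSD.
Qed.

Lemma forest_nclasses F : simple F -> forest F -> nclasses F + #|F| <= #|V|.
Proof.
have [n] := ubnP #|F|; elim: n F => // n IH F; rewrite ltnS => hn sF hF.
have [->|[e eF]] := set_0Vmem F; first by rewrite nclasses0 cards0 addn0.
have cF : #|F| = (#|F :\ e|).+1 by rewrite (cardsD1 e) eF.
have sD : simple (F :\ e) by apply: simpleS sF; apply: subsetDl.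
have fD : forest (F :\ e) by apply: forestS hF; apply: subsetDl.
have [p [q [_ De]]] := simple_ends sF eF.
have /hF : [set p; q] \in F by rewrite -De.
rewrite -De => /nclasses_merge; rewrite -De setD1K //.
have := IH (F :\ e); rewrite cF in hn * => /(_ hn sD fD).
by move=> h1 h2; apply: leq_trans h1; rewrite addnS -addSn leq_add2r.
Qed.

Lemma forestU1 F p q : p != q -> forest F -> ~~ conn F p q -> forest ([set p; q] |: F).
Proof.
move=> pq hF npq u v; rewrite in_setU1.
have eF : [set p; q] \notin F by apply: contra npq => /conn1.
have [E|ne] := eqVneq [set u; v] [set p; q] => /= H.
  rewrite E setU1K //; case: (set2_eq E) => [[-> ->]|[-> ->]] //.
  by rewrite conn_sym.
have nuv := hF _ _ H.
apply/negP; rewrite setDUl.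
have -> : [set [set p; q]] :\ [set u; v] = [set [set p; q]].
  by apply/setP=> f; rewrite !inE; case: (eqVneq f [set p; q]) => [->|];
    rewrite ?andbF // andbT eq_sym.
have sub : forall x y, conn (F :\ [set u; v]) x y -> conn F x y.
  by move=> x y; apply: connW; apply: subsetDl.
have cuv := conn1 H.
case/(conn_setU1 (erefl [set p; q])) => [/idPn//|[[/sub H1 /sub H2]|[/sub H1 /sub H2]]].
  case/negP: npq; apply: conn_trans (conn_trans _ cuv) _; last by rewrite conn_sym;
    exact: H2.
  by rewrite conn_sym.
case/negP: npq; apply: conn_trans H2 _; apply: conn_trans H1.
by rewrite conn_sym.
Qed.

End SimpleGraphs.

(** * Sparse edge sets *)

Lemma card_setE (T : finType) (A : {set T}) (P : pred T) :
  #|[set x in A | P x]| = \sum_(x in A) P x.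
Proof.
rewrite -sum1_card big_mkcond /= [RHS]big_mkcond.
by apply: eq_bigr => x _; rewrite inE; case: (x \in A).
Qed.

Section Sparse.
Variable V : finType.
Implicit Types (x y u v w : V) (S U P Q W : {set V}) (e f : {set V}).
Implicit Types (A B E F G X Y Z : {set {set V}}).

Lemma in_inside F U e : (e \in inside F U) = (e \in F) && (e \subset U).
Proof. by rewrite inE. Qed.

Lemma inside_sub F U : inside F U \subset F.
Proof. by apply/subsetP=> e; rewrite inE => /andP[]. Qed.

Lemma insideT F : inside F setT = F.
Proof. by apply/setP=> e; rewrite inE subsetT andbT. Qed.

Lemma insideE F U : #|inside F U| = \sum_(e in F) (e \subset U).
Proof. exact: card_setE. Qed.

Lemma degE F v : deg F v = \sum_(e in F) (v \in e).
Proof. exact: card_setE. Qed.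

Lemma deg_eq A B v : (forall e, v \in e -> (e \in A) = (e \in B)) -> deg A v = deg B v.
Proof.
move=> h; congr #|pred_of_set _|; apply/setP=> e; rewrite !inE.
by case ve: (v \in e); rewrite ?andbF // h.
Qed.

Lemma degD1 F e v : e \in F -> deg F v = (v \in e) + deg (F :\ e) v.
Proof. by move=> eF; rewrite !degE (big_setD1 e). Qed.

Lemma degU1 F e v : e \notin F -> deg (e |: F) v = (v \in e) + deg F v.
Proof. by move=> eF; rewrite !degE big_setU1. Qed.

Lemma deg_sub E F v : F \subset E -> deg F v <= deg E v.
Proof.
move=> sFE; apply: subset_leq_card; apply/subsetP=> e; rewrite !inE.
by case/andP=> /(subsetP sFE) -> ->.
Qed.

Lemma degU A B v : [disjoint A & B] -> deg (A :|: B) v = deg A v + deg B v.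
Proof.
move=> dAB; rewrite !degE big_mkcond [X in _ = X + _]big_mkcond [X in _ = _ +
  X]big_mkcond -big_split /=.
apply: eq_bigr => e _; rewrite inE.
have := disjointFr dAB (x := e); case: (e \in A) => [->//|_]; by rewrite ?addn0 ?add0n.
Qed.

Lemma insideU1 F e U : e \notin F -> #|inside (e |: F) U| = (e \subset U) + #|inside F U|.
Proof. by move=> eF; rewrite !insideE big_setU1. Qed.

Lemma insideD1 F e U : e \in F -> #|inside F U| = (e \subset U) + #|inside (F :\ e) U|.
Proof. by move=> eF; rewrite !insideE (big_setD1 e). Qed.

Lemma inside_supermod X U W :
  #|inside X U| + #|inside X W| <= #|inside X (U :|: W)| + #|inside X (U :&: W)|.
Proof.
rewrite -cardsUI; apply: leq_add; apply: subset_leq_card; apply/subsetP=> e; rewrite !inE.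
  by case/orP=> /andP[-> h]; rewrite (subset_trans h) // ?subsetUl ?subsetUr.
by case/andP=> /andP[-> h1] /andP[_ h2]; rewrite subsetI h1.
Qed.


Definition cut F P := [set e in F | (e :&: P != set0) && ~~ (e \subset P)].

Lemma sum_deg F P : simple F ->
  \sum_(v in P) deg F v = 2 * #|inside F P| + #|cut F P|.
Proof.
move=> sF; under eq_bigr do rewrite degE; rewrite exchange_big /=.
rewrite insideE big_distrr -sum1_card [\sum_(e in cut _ _) _]big_mkcond /= [in
  RHS]big_mkcond -big_split.
rewrite [LHS]big_mkcond; apply: eq_bigr => e _ /=; rewrite inE.
case eF: (e \in F) => //=.
have -> : \sum_(v in P) (v \in e) = #|e :&: P|.
  rewrite -sum1_card big_mkcond [RHS]big_mkcond; apply: eq_bigr => v _.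
  by rewrite inE andbC; case: (v \in P).
have [u [w [uw ->]]] := simple_ends sF eF.
rewrite set2_subset.
case uP: (u \in P); case wP: (w \in P) => //=.
- by rewrite (setIidPl _) ?set2_subset ?uP // cards2 uw andbF.
- have -> : [set u; w] :&: P = [set u].
    by apply/setP=> z; rewrite !inE; case: (eqVneq z u) => [->|_] /=; rewrite ?uP //;
      case: (eqVneq z w) => [->|].
  by rewrite cards1 andbT; case: eqP => // /setP/(_ u); rewrite !inE eqxx.
- have -> : [set u; w] :&: P = [set w].
    by apply/setP=> z; rewrite !inE; case: (eqVneq z w) => [->|_] /=;
      rewrite ?wP ?orbT //; case: (eqVneq z u) => [->|].
  by rewrite cards1 andbT; case: eqP => // /setP/(_ w); rewrite !inE eqxx.
- have -> : [set u; w] :&: P = set0.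
    by apply/setP=> z; rewrite !inE; case: (eqVneq z w) => [->|_] /=;
      rewrite ?wP ?andbF //; case: (eqVneq z u) => [->|].
  by rewrite cards0 eqxx.
Qed.

Lemma sum_degT F : simple F -> \sum_v deg F v = 2 * #|F|.
Proof.
move=> sF; have := sum_deg setT sF; rewrite insideT.
have -> : cut F setT = set0 by apply/setP=> e; rewrite !inE subsetT !andbF.
by rewrite cards0 addn0 => <-; apply: eq_bigl => v; rewrite inE.
Qed.

Variable m : nat.

(** The term [m] stands on the left to avoid truncated subtraction; in this form the bound would
    fail at the empty set for positive [m]. *)
Definition sparse X := [forall U : {set V},
  (U != set0) ==> (#|inside X U| + m <= m * #|U|)].

Definition tight X U := (U != set0) && (#|inside X U| + m == m * #|U|).

Lemma sparseP X : reflect (forall U, U != set0 -> #|inside X U| + m <= m * #|U|) (sparse X).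
Proof. by apply: (iffP forallP) => h U; apply/implyP; apply: h. Qed.

Lemma sparseS X Y : Y \subset X -> sparse X -> sparse Y.
Proof.
move=> sYX /sparseP hX; apply/sparseP=> U /hX; apply: leq_trans; rewrite leq_add2r.
apply: subset_leq_card; apply/subsetP=> e; rewrite !inE => /andP[/(subsetP sYX)-> ->] //.
Qed.

Lemma sparse0 : sparse set0.
Proof.
apply/sparseP=> U; rewrite -card_gt0 => U0.
have -> : inside set0 U = set0 by apply/setP=> e; rewrite !inE.
by rewrite cards0 add0n leq_pmulr.
Qed.

Lemma tight1 X v : simple X -> tight X [set v].
Proof.
move=> sX; rewrite /tight -card_gt0 cards1 /=.
have -> : inside X [set v] = set0; last by rewrite cards0 add0n muln1.
apply/setP=> e; rewrite !inE; case eX: (e \in X) => //=; apply/negP => /subset_leq_card.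
by rewrite (sX _ eX) cards1.
Qed.

(** The number of edges inside a set is supermodular and the bound is modular, so equality at [U]
    and [W] forces equality at union and intersection. Nonemptiness makes the bound available at the
    intersection. *)
Lemma tightUI X U W : sparse X -> tight X U -> tight X W -> U :&: W != set0 ->
  tight X (U :|: W) && tight X (U :&: W).
Proof.
move=> /sparseP hX /andP[U0 /eqP hU] /andP[W0 /eqP hW] UW0.
have UW1 : U :|: W != set0.
  by apply: contra U0 => /eqP/setP h; apply/eqP/setP=> z; move: (h z); rewrite !inE;
    case: (z \in U).
rewrite /tight UW0 UW1 /=.
have := hX _ UW0; have := hX _ UW1; have := inside_supermod X U W.
have E : m * #|U :|: W| + m * #|U :&: W| = m * #|U| + m * #|W| by rewrite -!mulnDr cardsUI.
by move=> h1 h2 h3; apply/andP; split; apply/eqP; card_lia.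
Qed.

Lemma tightU X U W : sparse X -> tight X U -> tight X W -> U :&: W != set0 ->
  tight X (U :|: W).
Proof. by move=> hX hU hW /(tightUI hX hU hW)/andP[]. Qed.

(* The counterpart of a fundamental circuit: [e] may be exchanged for any edge of
   [X] inside its hull. *)
Definition hull X e := \bigcap_(W | tight X W && (e \subset W)) W.

Lemma hull_tight X e : sparse X -> tight X setT -> e != set0 ->
  tight X (hull X e) && (e \subset hull X e).
Proof.
move=> hX hT e0; apply: (big_ind (fun W => tight X W && (e \subset W))) => //.
  by rewrite hT subsetT.
move=> U W /andP[hU eU] /andP[hW eW]; rewrite subsetI eU eW andbT.
have : U :&: W != set0.
  by apply: contraNneq e0 => UW0; rewrite -subset0 -UW0 subsetI eU.
by move=> /(tightUI hX hU hW)/andP[_ ->].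
Qed.

Lemma hull_min X e W : tight X W -> e \subset W -> hull X e \subset W.
Proof. by move=> hW eW; apply: bigcap_inf; rewrite hW. Qed.

(** A new edge raises each count by at most one, so a set that violates the bound was tight before
    and contains [e]. *)
Lemma sparseU1 X e : sparse X -> e \notin X -> e != set0 ->
  ~~ sparse (e |: X) -> exists2 W, tight X W & e \subset W.
Proof.
move=> /sparseP hX eX e0 /forallPn[W]; rewrite negb_imply => /andP[W0].
rewrite insideU1 // -ltnNge => h; have := hX _ W0.
move: h; case eW: (e \subset W) => //= h1 h2; last by move: h1 h2; lia.
by exists W; rewrite // /tight W0 /=; lia.
Qed.

Definition agree P A B := [forall e : {set V}, (e \subset P) || ((e \in A) == (e \in B))].

Lemma agreeP P A B : reflect (forall e, ~~ (e \subset P) ->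
  (e \in A) = (e \in B)) (agree P A B).
Proof.
apply: (iffP forallP) => h e; first by move=> eP; move: (h e); rewrite (negbTE eP) => /eqP.
by case eP: (e \subset P) => //=; rewrite h ?eP.
Qed.

Lemma agree_inside P A B W : agree P A B -> P \subset W ->
  #|inside A W| + #|inside B P| = #|inside B W| + #|inside A P|.
Proof.
move=> /agreeP h sPW.
have H F : #|inside F W| = #|inside F P| + #|[set e in F | (e \subset W) && ~~ (e \subset
  P)]|.
  rewrite -(cardsID (inside F P) (inside F W)); congr (_ + _).
    congr #|pred_of_set _|; apply/setP=> e; rewrite !inE; case: (e \in F) => //=.
    by case eP: (e \subset P); rewrite ?andbF // (subset_trans eP).
  congr #|pred_of_set _|; apply/setP=> e; rewrite !inE; case: (e \in F) => //=.
  by rewrite andbC.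
rewrite (H A) (H B).
have -> : [set e in A | (e \subset W) && ~~ (e \subset P)] = [set e in B | (e \subset W)
  && ~~ (e \subset P)].
  apply/setP=> e; rewrite !inE; case eP: (e \subset P); first by rewrite !andbF.
  by rewrite h ?eP.
lia.
Qed.

(** The sparse subsets of [G] of full size m(|V| - 1); by [nash_williams] they are unions of [m]
    disjoint spanning trees. *)
Definition base G X := [&& X \subset G, sparse X & tight X setT].

Lemma base_agree G P A B : base G A -> base G B -> agree P A B ->
  #|inside A P| = #|inside B P|.
Proof.
move=> /and3P[_ _ /andP[_ /eqP hA]] /and3P[_ _ /andP[_ /eqP hB]] hAB.
have := agree_inside hAB (subsetT P); lia.
Qed.

Lemma tight_agree P A B W : agree P A B -> #|inside A P| = #|inside B P| -> P \subset W ->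
  tight A W = tight B W.
Proof. by move=> hAB hP sPW; rewrite /tight; have := agree_inside hAB sPW;
  rewrite hP => /addIn ->. Qed.

Definition splice P A Z := inside A P :|: (Z :\: inside Z P).

Lemma in_splice P A Z e : (e \in splice P A Z) = if e \subset P then e \in A else e \in Z.
Proof. by rewrite !inE; case: (e \subset P); rewrite ?andbT ?andbF ?orbF //=;
  case: (e \in Z); rewrite ?andbF ?orbF. Qed.

Lemma splice_agree P A Z : agree P (splice P A Z) Z.
Proof. by apply/agreeP=> e eP; rewrite in_splice (negbTE eP). Qed.

Lemma inside_splice P A Z : inside (splice P A Z) P = inside A P.
Proof. by apply/setP=> e; rewrite !in_inside in_splice; case: (e \subset P);
  rewrite ?andbF. Qed.

(** Inside [W] the splice has the edges of [A] within [W :&: P] and those edges of [Z] that do not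
    lie within [P]. Supermodularity and tightness of [P] bound the latter by m(|W| - |W :&: P|), and
    the bound for [A] on [W :&: P] does the rest. *)
Lemma sparse_splice P A Z : sparse A -> sparse Z -> tight Z P -> simple Z -> simple A ->
  sparse (splice P A Z).
Proof.
move=> /sparseP hA /sparseP hZ /andP[P0 /eqP hP] sZ sA; apply/sparseP=> W W0.
have H F : #|inside F W| = #|inside F (W :&: P)| + #|[set e in F | (e \subset W) && ~~ (e
  \subset P)]|.
  rewrite -(cardsID (inside F P) (inside F W)); congr (_ + _); congr #|pred_of_set _|;
    apply/setP=> e; rewrite !inE.
    by rewrite subsetI; case: (e \in F).
  by case: (e \in F) => //=; rewrite andbC.
rewrite (H (splice P A Z)).
have -> : inside (splice P A Z) (W :&: P) = inside A (W :&: P).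
  by apply/setP=> e; rewrite !in_inside in_splice subsetI; case: (e \subset P);
    rewrite ?andbF.
have -> : [set e in splice P A Z | (e \subset W) && ~~ (e \subset P)] = [set e in Z | (e
  \subset W) && ~~ (e \subset P)].
  by apply/setP=> e; rewrite inE in_splice inE; case: (e \subset P); rewrite ?andbF.
have HZ := H Z; have [WP0|WP0] := eqVneq (W :&: P) set0.
  have -> : inside A (W :&: P) = set0.
    apply/setP=> e; rewrite WP0 in_inside subset0 inE; case: eqP => [->|];
      rewrite ?andbF ?andbT //.
    by apply/negP => /sA; rewrite cards0.
  have := hZ _ W0; rewrite cards0; lia.
have WP1 : W :|: P != set0.
  by apply: contra W0 => /eqP/setP h; apply/eqP/setP=> z; move: (h z); rewrite !inE;
    case: (z \in W).
have := hA _ WP0; have := hZ _ WP1; have := inside_supermod Z W P; have := cardsUI W P.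
have : m * #|W :|: P| + m * #|W :&: P| = m * #|W| + m * #|P| by rewrite -!mulnDr cardsUI.
lia.
Qed.

End Sparse.

(** * Toughness *)

Section Toughness.
Variable V : finType.
Implicit Types (x y u v w : V) (S U P Q W I : {set V}) (e f : {set V}).
Implicit Types (A B E F G X Y Z : {set {set V}}).

(* [I] meets each component of [E] minus [S] at most once. *)
Definition nat_tough t E := forall S I, I \subset ~: S ->
  (forall x y, x \in I -> y \in I -> conn (inside E (~: S)) x y -> x = y) ->
  #|I| <= 1 \/ t * #|I| <= #|S|.

Definition noncomplete E := exists u v, u != v /\ [set u; v] \notin E.

Variables (t : nat) (E : {set {set V}}).
Hypotheses (sE : simple E) (tE : nat_tough t E) (ncE : noncomplete E).

(** Toughness for the set of [u] and [v]; the colouring [c] certifies that they lie in different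
    components. *)
Lemma tough_sep S u v (c : pred V) : u \notin S -> v \notin S -> c u -> ~~ c v ->
  (forall x y, x \notin S -> y \notin S -> [set x; y] \in E -> c x = c y) -> 2 * t <= #|S|.
Proof.
move=> uS vS cu cv hc; have uv : u != v by apply: contraNneq cv => <-.
have [|||] := tE (S := S) (I := [set u; v]).
- by rewrite set2_subset !inE uS.
- have hcc x y : conn (inside E (~: S)) x y -> c x = c y.
    apply: (@conn_invariant _ _ bool) => z z'.
    by rewrite in_inside set2_subset !inE => /and3P[h1 h2 h3]; apply: hc.
  move=> x y; rewrite !inE => /orP[]/eqP-> /orP[]/eqP-> // /hcc; rewrite cu (negbTE cv) //.
- by rewrite cards2 uv.
- by rewrite cards2 uv; lia.
Qed.

Lemma card_noncomplete : 2 * t + 2 <= #|V|.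
Proof.
have [u [v [uv nuv]]] := ncE.
have /leq_trans : 2 * t <= #|~: [set u; v]|.
  apply: (@tough_sep _ u v (pred1 u)); rewrite ?inE ?eqxx ?orbT //= 1?eq_sym //.
  move=> x y; rewrite !inE !negbK => /orP[]/eqP-> /orP[]/eqP-> //.
    by rewrite (negbTE nuv).
  by rewrite setUC (negbTE nuv).
have := cardsC [set u; v]; rewrite cards2 uv => h; move/(_ _ (leqnn _)).
card_lia.
Qed.

Definition between F P Q := [set e in F | (e :&: P != set0) && (e :&: Q != set0)].

Lemma betweenC F P Q : between F P Q = between F Q P.
Proof. by apply/setP=> e; rewrite !inE andbCA; case: (e \in F); rewrite //= andbC. Qed.

Definition boundary P Q := [set v in P | [exists w in Q, [set v; w] \in E]].

Lemma card_boundary P Q : [disjoint P & Q] -> #|boundary P Q| <= #|between E P Q|.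
Proof.
move=> dPQ; pose g v := odflt v [pick w in Q | [set v; w] \in E].
have gP v : v \in boundary P Q -> [/\ v \in P, g v \in Q & [set v; g v] \in E].
  rewrite inE => /andP[vP /exists_inP[w wQ wE]]; rewrite /g.
  by case: pickP => [w' /andP[]|/(_ w)] //=; rewrite wQ wE.
rewrite -(card_in_imset (f := fun v => [set v; g v])).
  apply/subset_leq_card/subsetP=> _ /imsetP[v /gP[vP gQ vE] ->]; rewrite inE vE /=.
  apply/andP; split; apply/set0Pn; [exists v|exists (g v)]; rewrite !inE eqxx ?orbT //=.
move=> v w /gP[vP gQ _] /gP[wP gQ' _] /set2_eq[[]//|[h _]].
by move: (disjointFr dPQ vP); rewrite h gQ'.
Qed.

(** If one side has a vertex off its boundary, deleting [S] and that boundary separates this vertex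
    from the other side, and the boundary is no larger than the cut. *)
Lemma cut_lb S P : P \subset ~: S -> P != set0 -> P != ~: S ->
  2 * t <= #|S| + 2 * #|cut (inside E (~: S)) P|.
Proof.
move=> sPS /set0Pn[p pP] nP; pose Q := ~: S :\: P.
have [q qQ] : exists q, q \in Q.
  apply/set0Pn; apply: contra nP; rewrite setD_eq0 => sSP.
  by rewrite eqEsubset sPS sSP.
have dPQ : [disjoint P & Q] by rewrite disjoints_subset; apply/subsetP=> z zP;
  rewrite !inE zP.
have PS z : z \in P -> z \notin S by move/(subsetP sPS); rewrite inE.
have QS z : z \in Q -> z \notin S by rewrite !inE => /andP[].
have sub : between E P Q \subset between (inside E (~: S)) P Q.
  apply/subsetP=> e; rewrite !inE => /and3P[eE eP eQ]; rewrite eE eP eQ !andbT /=.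
  have [x [y [xy De]]] := simple_ends sE eE; move: eP eQ; rewrite De set2_subset.
  case/set0Pn=> a; rewrite !inE => /andP[/orP[]/eqP-> aP] /set0Pn[b];
    rewrite in_setI in_set2 => /andP[/orP[]/eqP-> bQ]; rewrite ?(PS _ aP) ?(QS _ bQ) //.
    by move: (disjointFr dPQ aP); rewrite bQ.
  by move: (disjointFr dPQ aP); rewrite bQ.
have sub2 : between (inside E (~: S)) P Q \subset cut (inside E (~: S)) P.
  apply/subsetP=> e; rewrite !inE => /and3P[-> -> /set0Pn[z]];
    rewrite !inE => /and3P[ze zP _] /=.
  by apply: contra zP => /subsetP/(_ _ ze).
have hPQ : #|boundary P Q| <= #|cut (inside E (~: S)) P|.
  apply: leq_trans (card_boundary dPQ) _; apply/subset_leq_card/(subset_trans sub sub2).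
have hQP : #|boundary Q P| <= #|cut (inside E (~: S)) P|.
  have dQP : [disjoint Q & P] by rewrite disjoint_sym.
  apply: leq_trans (card_boundary dQP) _; rewrite betweenC;
    apply/subset_leq_card/(subset_trans sub sub2).
have cover x : x \notin S -> (x \in P) || (x \in Q) by rewrite !inE => ->;
  rewrite andbT orbN.
have sep P' Q' p' q' : [disjoint P' & Q'] -> p' \in P' -> q' \in Q' ->
  (forall z, z \in P' -> z \notin S) ->
    (forall z, z \in Q' -> z \notin S) -> (forall x, x \notin S ->
      (x \in P') || (x \in Q')) ->
    p' \notin boundary P' Q' -> 2 * t <= #|S| + #|boundary P' Q'|.
  move=> d p'P q'Q hP hQ cov p'b; apply: leq_trans (leq_card_setU S (boundary P' Q')).
  apply: (@tough_sep _ p' q' (mem P')); rewrite ?p'P //=.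
  - by rewrite inE negb_or hP.
  - by rewrite inE negb_or hQ // inE (disjointFl d q'Q).
  - by rewrite (disjointFl d q'Q).
  have key x y : x \notin S :|: boundary P' Q' -> y \notin S :|: boundary P' Q' ->
    [set x; y] \in E -> x \in P' -> y \in P'.
    rewrite !inE !negb_or => /andP[xS xb] /andP[yS _] xyE xP.
    move: xb; rewrite xP /=; apply: contraNT => yP; apply/exists_inP; exists y => //.
    by move: (cov _ yS); rewrite (negbTE yP).
  move=> x y hx hy xyE; apply/idP/idP; first exact: key.
  by apply: key => //; rewrite setUC.
have [PP|/subsetPn[p' p'P p'b]] := boolP (P \subset boundary P Q); last first.
  have := sep _ _ p' q dPQ p'P qQ PS QS cover p'b; lia.
have [QQ|/subsetPn[q' q'Q q'b]] := boolP (Q \subset boundary Q P); last first.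
  have dQP : [disjoint Q & P] by rewrite disjoint_sym.
  have cover' x : x \notin S -> (x \in Q) || (x \in P) by move/cover; rewrite orbC.
  have := sep _ _ q' p dQP q'Q pP QS PS cover' q'b; lia.
(* Now every vertex outside [S] is on a boundary, so each side has at most as many vertices as the
   cut has edges. Hence the factor 2; |V| >= 2t + 2 concludes. *)
have := subset_leq_card PP; have := subset_leq_card QQ; have := card_noncomplete.
have := cardsC S; have := cardsID P (~: S); rewrite (setIidPr sPS) -/Q.
lia.
Qed.

End Toughness.

(** * Existence of bases *)

Section Bases.
Variable V : finType.
Implicit Types (x y u v w : V) (S U P Q W I : {set V}) (e f : {set V}).
Implicit Types (A B E F X Y Z : {set {set V}}).
Variables (m : nat) (G : {set {set V}}).
Hypotheses (m_gt0 : 0 < m) (sG : simple G).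

Lemma sum_blocks (M : V -> {set V}) (F : {set V}) (f : V -> nat) :
  (forall v, v \in F -> v \in M v /\ M v \subset F) ->
  (forall u v, v \in F -> u \in M v -> M u = M v) ->
  \sum_(v in F) f v = \sum_(P in M @: F) \sum_(v in P) f v.
Proof.
move=> h1 h2; rewrite (partition_big_imset M) /=; apply: eq_bigr => _ /imsetP[w wF ->].
apply: eq_bigl => v; apply/andP/idP => [[vF /eqP <-]|vw]; first by case: (h1 v vF).
by rewrite (h2 _ _ wF vw) eqxx; split=> //; case: (h1 w wF) => _ /subsetP; apply.
Qed.

Lemma base_card X : base m G X -> #|X| + m = m * #|V|.
Proof. by case/and3P=> _ _ /andP[_ /eqP]; rewrite insideT cardsT. Qed.

Section Blocks.
Variable piece : pred {set V}.
Hypothesis pieceU : forall P Q, piece P -> piece Q -> P :&: Q != set0 -> piece (P :|: Q).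

(** For a family closed under intersecting unions these are its maximal members, and they partition
    the vertices it covers. Applied to tight sets and to pieces. *)
Definition block v := \bigcup_(W : {set V} | piece W && (v \in W)) W.

Lemma block_sup v W : piece W -> v \in W -> W \subset block v.
Proof. by move=> pW vW; apply: bigcup_sup; rewrite pW. Qed.

Lemma block_piece v P : piece P -> v \in P -> piece (block v) && (v \in block v).
Proof.
move=> pP vP; have vB := subsetP (block_sup pP vP) _ vP.
pose K (B : {set V}) := B = set0 \/ piece B && (v \in B).
suff [B0|//] : K (block v) by rewrite B0 inE in vB.
apply: (big_ind K) => [|B C|W /andP[pW vW]]; [by left| |by right; rewrite pW].
case=> [->|/andP[pA vA]]; first by rewrite set0U.
case=> [->|/andP[pB vB']]; first by rewrite setU0; right; rewrite pA.
right; rewrite pieceU ?inE ?vA //; apply/set0Pn; exists v; by rewrite inE vA.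
Qed.

Lemma block_eq u v P : piece P -> v \in P -> u \in block v -> block u = block v.
Proof.
move=> pP vP ub; have /andP[pB vB] := block_piece pP vP.
have sBu := block_sup pB ub; apply/eqP; rewrite eqEsubset sBu andbT.
have /andP[pBu _] := block_piece pB ub.
by apply: block_sup => //; apply: (subsetP sBu).
Qed.

End Blocks.

(** Take a maximal sparse [X] and its maximal tight sets. An edge of [G] leaving one of them is in
    [X], since otherwise it could be added or would lie in a tight set that extends the block. If no
    block is all of [V], the average degree of [X] is at least 2m, against |X| <= m(|V| - 1). *)
Lemma base_exists : 0 < #|V| -> (forall P, P != set0 -> P != setT -> 2 * m <= #|cut G P|) ->
  exists X, base m G X.
Proof.
move=> V0 hcut; pose good X := (X \subset G) && sparse m X.
have g0 : good set0 by rewrite /good sub0set sparse0.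
case: (arg_maxnP (fun X : {set {set V}} => #|X|) g0) => X /andP[sXG hX] maxX.
have sX : simple X by apply: simpleS sG.
exists X; rewrite /base sXG hX /=.
have tU P Q : tight m X P -> tight m X Q -> P :&: Q != set0 ->
  tight m X (P :|: Q) by exact: tightU.
pose M := block (tight m X).
have tM v : tight m X (M v) && (v \in M v) by exact: (block_piece tU (tight1 m v sX)
  (set11 v)).
have eM u v : u \in M v -> M u = M v by exact: (block_eq tU (tight1 m v sX) (set11 v)).
apply/negPn/negP => nT.
have MT v : M v != setT by apply: contraNneq nT => <-; case/andP: (tM v).
(* The edges inside contribute 2m(|M v| - 1), and the cut supplies the missing 2m. *)
have degM v : 2 * m * #|M v| <= \sum_(w in M v) deg X w.
  have /andP[tv vM] := tM v; rewrite sum_deg //.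
  have -> : cut X (M v) = cut G (M v).
    apply/eqP; rewrite eqEsubset; apply/andP; split; apply/subsetP=> e; rewrite !inE.
      by case/andP=> /(subsetP sXG) -> ->.
    case/andP=> eG eM'; rewrite eM' andbT; apply/negPn/negP => eX.
    case/andP: eM' => /set0Pn[z]; rewrite inE => /andP[ze zM] /negP; apply.
    have e0 : e != set0 by apply/set0Pn; exists z.
    have nsp : ~~ sparse m (e |: X).
      apply/negP => sp; have := maxX (e |: X); rewrite /good sp subUset sub1set eG sXG.
      by move/(_ isT); rewrite cardsU1 eX /=; card_lia.
    have [W tW eW] := sparseU1 hX eX e0 nsp.
    have := block_sup tW (subsetP eW _ ze); rewrite -/M (eM _ _ zM); exact: subset_trans.
  have M0 : M v != set0 by apply/set0Pn; exists v.
  have := hcut _ M0 (MT v); case/andP: tv => _ /eqP.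
  rewrite -mulnA; card_lia.
have : 2 * m * #|V| <= \sum_(v in [set: V]) deg X v.
  rewrite (@sum_blocks M setT); first last.
  - by move=> u v _; apply: eM.
  - by move=> v _; case/andP: (tM v) => _ ->; rewrite subsetT.
  have -> : #|V| = \sum_(P in M @: setT) #|P|.
    rewrite -cardsT -sum1_card (@sum_blocks M setT); first last.
    - by move=> u v _; apply: eM.
    - by move=> v _; case/andP: (tM v) => _ ->; rewrite subsetT.
    by apply: eq_bigr => P _; rewrite sum1_card.
  rewrite big_distrr; apply: leq_sum => _ /imsetP[v _ ->]; exact: degM.
have -> : \sum_(v in [set: V]) deg X v = 2 * #|X|.
  by rewrite -sum_degT //; apply: eq_bigl => v; rewrite inE.
have VT0 : [set: V] != set0 by rewrite -card_gt0 cardsT.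
move/sparseP: hX => /(_ _ VT0); rewrite insideT cardsT -mulnA leq_mul2l /=.
by move=> h1 h2; have := leq_trans h1 h2; rewrite -{2}[#|X|]addn0 leq_add2l leqNgt m_gt0.
Qed.

End Bases.

(** * Bases of small degree *)

Section LocalSearch.
Variable V : finType.
Implicit Types (x y z u v w : V) (S U P Q W I : {set V}) (e f : {set V}).
Implicit Types (A B E F X Y Z : {set {set V}}).
Variables (m h : nat) (G : {set {set V}}).
Hypotheses (m_gt0 : 0 < m) (sG : simple G).

Lemma base_simple X : base m G X -> simple X.
Proof. by case/and3P=> /simpleS h1 _ _; apply: h1. Qed.

(** The potential of the search: truncation makes only the vertices above [h] count. *)
Definition excess X := \sum_v (deg X v - h).

(* [u] can be made to have degree below [h] by changing [X] inside [P] only. *)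
Definition recipe X P u Y := [&& base m G Y, agree P Y X,
  [forall v in P, deg Y v <= h] & deg Y u < h].

(** Pieces play the role of the growing components of the Fürer-Raghavachari search, and recipes
    that of unblocking a vertex. Tightness is what lets recipes of disjoint pieces be spliced
    together. *)
Definition piece X P := [&& tight m X P, [forall v in P, deg X v <= h] &
  [forall u in P, [exists Y : {set {set V}}, recipe X P u Y]]].

Lemma recipeP X P u Y : reflect [/\ base m G Y, agree P Y X, (forall v, v \in P ->
  deg Y v <= h) & deg Y u < h]
  (recipe X P u Y).
Proof.
apply: (iffP and4P) => [] [h1 h2 h3 h4]; split=> //; first by move=> v; apply/forall_inP: v.
exact/forall_inP.
Qed.

Lemma pieceP X P : reflect [/\ tight m X P, (forall v, v \in P -> deg X v <= h) &
  (forall u, u \in P -> exists Y, recipe X P u Y)] (piece X P).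
Proof.
apply: (iffP and3P) => [] [h1 h2 h3]; split=> //.
- by move=> v; apply/forall_inP: v.
- by move=> v /(forall_inP h3)/existsP.
- exact/forall_inP.
- by apply/forall_inP => v /h3/existsP.
Qed.

Lemma deg_agree P A B v : agree P A B -> v \notin P -> deg A v = deg B v.
Proof.
move=> /agreeP hAB vP; apply: deg_eq => e ve; apply: hAB.
by apply: contra vP => /subsetP/(_ _ ve).
Qed.

Lemma agreeS P Q A B : P \subset Q -> agree P A B -> agree Q A B.
Proof.
move=> sPQ /agreeP hAB; apply/agreeP=> e eQ; apply: hAB.
by apply: contra eQ => /subset_trans; apply.
Qed.


Variable X : {set {set V}}.
Hypothesis bX : base m G X.

Lemma piece1 v : deg X v < h -> piece X [set v].
Proof.
move=> dv; apply/pieceP; split.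
- exact: tight1 (base_simple bX).
- by move=> w /set1P->; apply: ltnW.
move=> w /set1P->; exists X; apply/recipeP; split=> //.
  by apply/agreeP.
by move=> z /set1P->; apply: ltnW.
Qed.

Lemma recipe_widen P Q u Y : (forall v, v \in Q -> deg X v <= h) -> P \subset Q ->
  recipe X P u Y -> recipe X Q u Y.
Proof.
move=> dQ sPQ /recipeP[h1 h2 h3 h4]; apply/recipeP; split=> //; first exact: agreeS h2.
move=> v vQ; have [/h3//|vP] := boolP (v \in P).
by rewrite (deg_agree h2 vP) dQ.
Qed.

Lemma pieceU P Q : piece X P -> piece X Q -> P :&: Q != set0 -> piece X (P :|: Q).
Proof.
case/pieceP=> tP dP rP /pieceP[tQ dQ rQ] PQ.
have dU v : v \in P :|: Q -> deg X v <= h by rewrite inE => /orP[/dP|/dQ].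
have /and3P[_ spX _] := bX.
apply/pieceP; split=> //; first exact: tightU.
move=> u; rewrite inE => /orP[/rP|/rQ] [Y hY]; exists Y; apply: recipe_widen hY => //.
  exact: subsetUl.
exact: subsetUr.
Qed.

Lemma deg_tight U v : tight m X U -> 1 < #|U| -> v \in U ->
  exists e, [/\ e \in X, e \subset U & v \in e].
Proof.
case/andP=> U0 /eqP hU cU vU; have /and3P[_ /sparseP spX _] := bX.
have cD : #|U| = (#|U :\ v|).+1 by rewrite (cardsD1 v) vU.
have UD0 : U :\ v != set0 by rewrite -card_gt0; card_lia.
have lt : #|inside X (U :\ v)| < #|inside X U|.
  by have := spX _ UD0; rewrite cD mulnS in hU; card_lia.
have /subsetPn[e] : ~~ (inside X U \subset inside X (U :\ v)).
  by apply/negP => /subset_leq_card; rewrite leqNgt lt.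
rewrite !in_inside => /andP[eX eU] ne; exists e; split=> //.
apply: contraR ne => ve; rewrite eX; apply/subsetP=> z ze;
  rewrite !inE (subsetP eU _ ze) andbT.
by apply: contraNneq ve => <-.
Qed.

(** A set that gains [e'] without losing [e] is not tight, so it has room for one more edge. *)
Lemma base_exchange Y e e' : base m G Y -> e \in Y -> e' \in G -> e' \notin Y ->
  (forall W, tight m Y W -> e' \subset W -> e \subset W) -> base m G (e' |: (Y :\ e)).
Proof.
case/and3P=> sYG /sparseP hY hT eY e'G e'Y hW.
have nD : e' \notin Y :\ e by rewrite inE (negbTE e'Y) andbF.
have cnt W : (e \subset W) + #|inside (e' |: (Y :\ e)) W| = (e' \subset W) + #|inside Y W|.
  by rewrite insideU1 // (insideD1 _ eY); card_lia.
apply/and3P; split.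
- by rewrite subUset sub1set e'G (subset_trans _ sYG) // subsetDl.
- apply/sparseP=> W W0; have := cnt W; have := hY _ W0; have := hW W; rewrite /tight W0 /=.
  case: (e' \subset W); case: (e \subset W); move=> /= h1 h2 h3; try by card_lia.
  have : (#|inside Y W| + m == m * #|W|) = false by apply/negP => /h1/(_ isT).
  card_lia.
- case/andP: hT => T0 /eqP hT; rewrite /tight T0 /=; have := cnt setT; rewrite !subsetT;
    card_lia.
Qed.

Section Join.
Variables (P Q : {set V}) (Yp Yq : {set {set V}}) (u w : V).
Hypotheses (tP : tight m X P) (tQ : tight m X Q) (dPQ : [disjoint P & Q]).
Hypotheses (uP : u \in P) (wQ : w \in Q) (rP : recipe X P u Yp) (rQ : recipe X Q w Yq).
Hypotheses (eG : [set u; w] \in G) (eX : [set u; w] \notin X).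

Let U0 := hull m X [set u; w].
Let R := U0 :|: P :|: Q.

Lemma join_tight : tight m X R.
Proof.
have /and3P[_ spX tT] := bX; have e0 : [set u; w] != set0 by apply/set0Pn; exists u;
  rewrite set21.
have /andP[t0 e0s] := hull_tight spX tT e0; move: e0s; rewrite set2_subset => /andP[u0 w0].
apply: tightU => //; last by apply/set0Pn; exists w; rewrite !inE w0 wQ.
by apply: tightU => //; apply/set0Pn; exists u; rewrite !inE u0 uP.
Qed.

(** The recipes bring [u] and [w] below [h]. Then [[set u; w]] enters and an edge at [v] inside its
    hull leaves; this lowers [v] and keeps the ends of the new edge within [h]. *)
Lemma join_recipe v : v \in U0 -> v \notin P -> v \notin Q ->
  exists Y, [/\ base m G Y, agree R Y X, (forall z, z \in P :|: Q -> deg Y z <= h),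
    (forall z, z \notin P :|: Q -> deg Y z <= deg X z) & deg Y v = (deg X v).-1].
Proof.
move=> v0 vP vQ.
have /recipeP[bYp ap dp du] := rP; have /recipeP[bYq aq dq dw] := rQ.
have sX := base_simple bX; have sYp := base_simple bYp; have sYq := base_simple bYq.
have /and3P[_ spX tT] := bX; have /and3P[_ spYp tYpT] := bYp; have /and3P[_ spYq _] := bYq.
have e0 : [set u; w] != set0 by apply/set0Pn; exists u; rewrite set21.
have /andP[t0 e0s] := hull_tight spX tT e0; rewrite -/U0 in t0 e0s.
have disj (e : {set V}) : e != set0 -> e \subset P -> e \subset Q -> false.
  by move=> /set0Pn[z ze] /subsetP/(_ _ ze) zP /subsetP/(_ _ ze);
    rewrite (disjointFr dPQ zP).
have nz F (e : {set V}) : simple F -> e \in F -> e != set0.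
  by move=> sF /sF; case: eqP => // ->; rewrite cards0.
(* The two recipes change [X] inside disjoint sets, so both can be applied. *)
pose Y := splice Q Yq Yp.
have inYp : inside Yp Q = inside X Q.
  apply/setP=> e; rewrite !in_inside; case eQ: (e \subset Q); rewrite ?andbF ?andbT //.
  have [->|en] := eqVneq e set0.
    apply/idP/idP => [/(nz _ _ sYp)|/(nz _ _ sX)]; by rewrite eqxx.
  by apply/(agreeP _ _ _ ap)/negP => /(disj _ en)/(_ eQ).
have tYpQ : tight m Yp Q by rewrite /tight inYp; case/andP: tQ => -> ->.
have cQ : #|inside Y Q| = #|inside Yp Q|.
  by rewrite inside_splice inYp; apply: base_agree bYq bX aq.
have aYQ : agree Q Y Yp by apply: splice_agree.
have bY : base m G Y.
  apply/and3P; split.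
  - apply/subsetP=> e; rewrite in_splice; case: ifP => _.
      by case/and3P: bYq => /subsetP h1 _ _ /h1.
    by case/and3P: bYp => /subsetP h1 _ _ /h1.
  - exact: sparse_splice.
  - by rewrite (tight_agree m aYQ cQ (subsetT _)).
have aY : agree (P :|: Q) Y X.
  apply/agreeP=> e eR; rewrite in_splice ifN; last by apply: contra eR => /subset_trans;
    apply; apply: subsetUr.
  by apply: (agreeP _ _ _ ap); apply: contra eR => /subset_trans; apply; apply: subsetUl.
have aYe e : ~~ (e \subset P) -> ~~ (e \subset Q) -> (e \in Y) = (e \in X).
  by move=> eP eQ; rewrite in_splice (negbTE eQ); apply: (agreeP _ _ _ ap).
have dYP z : z \in P -> deg Y z = deg Yp z.
  by move=> zP; apply: deg_agree aYQ _; rewrite (disjointFr dPQ zP).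
have dYQ z : z \in Q -> deg Y z = deg Yq z.
  move=> zQ; apply: deg_eq => e ze; rewrite in_splice; case: ifPn => // eQ.
  rewrite (agreeP _ _ _ aq) //; apply: (agreeP _ _ _ ap).
  by apply/negP => /subsetP/(_ _ ze) zP; rewrite (disjointFr dPQ zP) in zQ.
have dYn z : z \notin P :|: Q -> deg Y z = deg X z by apply: deg_agree aY.
have vPQ : v \notin P :|: Q by rewrite inE negb_or vP.
have nP : ~~ ([set u; w] \subset P) by rewrite set2_subset uP /=; apply/negP => wP;
  have := disjointFr dPQ wP; rewrite wQ.
have nQ : ~~ ([set u; w] \subset Q) by rewrite set2_subset wQ andbT (disjointFr dPQ uP).
have e'Y : [set u; w] \notin Y by rewrite aYe.
have uw : u != w by apply: (simple_neq sG).
have cU0 : 1 < #|U0| by have := subset_leq_card e0s; rewrite cards2 uw.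
have [f [fX fU vf]] := deg_tight t0 cU0 v0.
have fP : ~~ (f \subset P) by apply: contra vP => /subsetP/(_ _ vf).
have fQ : ~~ (f \subset Q) by apply: contra vQ => /subsetP/(_ _ vf).
have fY : f \in Y by rewrite aYe.
have spY : sparse m Y by case/and3P: bY.
have cYP : #|inside Y P| = #|inside X P|.
  rewrite -(base_agree bYp bX ap); congr #|pred_of_set _|; apply/setP=> e.
  rewrite !in_inside in_splice; case eP: (e \subset P); rewrite ?andbF ?andbT //.
  case: ifPn => // eQ; have [->|en] := eqVneq e set0.
    apply/idP/idP => [/(nz _ _ sYq)|/(nz _ _ sYp)]; by rewrite eqxx.
  by have := disj _ en eP eQ.
have tYP : tight m Y P by rewrite /tight cYP; case/andP: tP => -> ->.
have tYQ : tight m Y Q by rewrite /tight cQ inYp; case/andP: tQ => -> ->.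
(* The hull belongs to [X], but the exchange happens in [Y]. If [W] missed [f], its union with [P]
   and [Q] would be tight without [f]; by sparsity of [Y] it would not contain [f] and would be
   tight in [Y], hence in [X]. But then it includes the hull, and so [f]. *)
have exch W : tight m Y W -> [set u; w] \subset W -> f \subset W.
  move=> tW eW; apply/negPn/negP => fW.
  have spD : sparse m (Y :\ f) by apply: sparseS spY; apply: subsetDl.
  have tD (Z : {set V}) : ~~ (f \subset Z) -> tight m (Y :\ f) Z = tight m Y Z.
    by move=> fZ; rewrite /tight (insideD1 _ fY) (negbTE fZ).
  have [uW wW] : u \in W /\ w \in W by apply/andP; rewrite -set2_subset.
  have [dW dP dQ] : [/\ tight m (Y :\ f) W,
    tight m (Y :\ f) P & tight m (Y :\ f) Q] by rewrite !tD.
  have t1 : tight m (Y :\ f) (W :|: P :|: Q).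
    apply: tightU => //; last by apply/set0Pn; exists w; rewrite !inE wW wQ.
    by apply: tightU => //; apply/set0Pn; exists u; rewrite !inE uW uP.
  have fW' : ~~ (f \subset W :|: P :|: Q).
    apply/negP => fW'; case/andP: t1 => W0 /eqP; move/sparseP: spY => /(_ _ W0).
    by rewrite (insideD1 _ fY) fW'; card_lia.
  have t2 : tight m Y (W :|: P :|: Q) by rewrite -tD.
  have t3 : tight m X (W :|: P :|: Q).
    rewrite -(tight_agree m aY _ _) // -?setUA ?subsetUr //.
    exact: base_agree bY bX aY.
  have := hull_min t3 (W := W :|: P :|: Q) (e := [set u; w]).
  rewrite -setUA (subset_trans eW) ?subsetUl // => /(_ isT)/(subset_trans fU).
  by rewrite setUA (negbTE fW').
have bY' := base_exchange bY fY eG e'Y exch.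
have nD : [set u; w] \notin Y :\ f by rewrite inE (negbTE e'Y) andbF.
have dY' z : (z \in f) + deg ([set u; w] |: (Y :\ f)) z = (z \in [set u; w]) + deg Y z.
  by rewrite degU1 // (degD1 z fY) addnCA.
have eR : [set u; w] \subset R by rewrite set2_subset !inE uP wQ !orbT.
exists ([set u; w] |: (Y :\ f)); split=> //.
- apply/agreeP=> e eR'; rewrite in_setU1 in_setD1.
  have -> : (e == [set u; w]) = false by apply: contraNF eR' => /eqP->.
  have -> : e != f by apply: contraNneq eR' => ->; apply: subset_trans fU _;
    rewrite /R -setUA subsetUl.
  by rewrite /=; apply: (agreeP _ _ _ aY); apply: contra eR' => /subset_trans; apply;
    rewrite /R -setUA subsetUr.
- move=> z zPQ; have := dY' z; rewrite !inE.
  have [zu|zu] := eqVneq z u.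
    move: du; rewrite -zu -dYP; last by rewrite zu.
    by case: (_ || _); case: (_ \in f) => /=; card_lia.
  have [zw|zw] := eqVneq z w.
    move: dw; rewrite -zw -dYQ; last by rewrite zw.
    by case: (_ \in f) => /=; card_lia.
  move: zPQ; rewrite inE => /orP[zP|zQ].
    by have := dp _ zP; rewrite -dYP //; case: (z \in f) => /=; card_lia.
  by have := dq _ zQ; rewrite -dYQ //; case: (z \in f) => /=; card_lia.
- move=> z zPQ; have := dY' z; rewrite dYn //; have -> : z \in [set u; w] = false.
    by apply: contraNF zPQ; rewrite !inE => /orP[]/eqP->; rewrite ?uP ?wQ ?orbT.
  by case: (z \in f) => /=; card_lia.
- have := dY' v; rewrite dYn // vf; have -> : v \in [set u; w] = false.
    by apply: contraNF vPQ; rewrite !inE => /orP[]/eqP->; rewrite ?uP ?wQ ?orbT.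
  by card_lia.
Qed.

End Join.

Hypothesis minX : forall Y, base m G Y -> excess X <= excess Y.

(** Consequently all edges of [G] between different maximal pieces are in [X], which turns toughness
    of [G] into counting in [X]. *)
Lemma piece_join P Q u w : piece X P -> piece X Q -> u \in P -> w \in Q ->
  [set u; w] \in G -> [set u; w] \notin X ->
  exists R, [/\ piece X R, u \in R & w \in R].
Proof.
move=> pP pQ uP wQ eG eX.
have [PQ|PQ] := boolP (P :&: Q != set0).
  by exists (P :|: Q); rewrite pieceU // !inE uP wQ orbT.
have dPQ : [disjoint P & Q] by rewrite -setI_eq0; apply/negPn.
have /pieceP[tP dP rP] := pP; have /pieceP[tQ dQ rQ] := pQ.
have [Yp hYp] := rP _ uP; have [Yq hYq] := rQ _ wQ.
set U0 := hull m X [set u; w].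
exists (U0 :|: P :|: Q); rewrite !inE uP wQ !orbT; split=> //.
have key v : v \in U0 -> v \notin P -> v \notin Q -> exists Y,
    [/\ base m G Y, agree (U0 :|: P :|: Q) Y X, (forall z, z \in P :|: Q -> deg Y z <= h),
    (forall z, z \notin P :|: Q -> deg Y z <= deg X z) & deg Y v = (deg X v).-1].
  exact: (join_recipe tP tQ dPQ uP wQ hYp hYq eG eX).
(* A hull vertex above [h] would lose an edge while [P] and [Q] stay within [h] and no other degree
   grows, so the excess would drop. *)
have dU v : v \in U0 :|: P :|: Q -> deg X v <= h.
  have [/dP//|vP] := boolP (v \in P); have [/dQ//|vQ] := boolP (v \in Q).
  rewrite !inE (negbTE vP) (negbTE vQ) !orbF => vU; rewrite leqNgt; apply/negP => dv.
  have [Y [bY _ d1 d2 d3]] := key _ vU vP vQ.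
  have := minX bY; rewrite leqNgt => /negP; apply; rewrite /excess.
  rewrite (bigD1 v) //= [X in _ < X](bigD1 v) //= d3 -addSn leq_add //; first by card_lia.
  apply: leq_sum => z _; have [zPQ|zPQ] := boolP (z \in P :|: Q);
    last by rewrite leq_sub2r ?d2.
  by move: (d1 _ zPQ); rewrite -subn_eq0 => /eqP->.
apply/pieceP; split=> //; first exact: join_tight tP tQ uP wQ.
move=> v vR; have [/rP[Y hY]|vP] := boolP (v \in P).
  by exists Y; apply: recipe_widen hY => //; rewrite -setUA setUCA subsetUl.
have [/rQ[Y hY]|vQ] := boolP (v \in Q).
  by exists Y; apply: recipe_widen hY => //; rewrite subsetUr.
have vU : v \in U0 by move: vR; rewrite !inE (negbTE vP) (negbTE vQ) !orbF.
have [Y [bY a d1 d2 d3]] := key _ vU vP vQ; exists Y; apply/recipeP; split=> //.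
  move=> z zR; have [/d1//|zPQ] := boolP (z \in P :|: Q).
  exact: leq_trans (d2 _ zPQ) (dU _ zR).
have d0 : 0 < deg X v.
  have /and3P[_ spX tT] := bX; have e0 : [set u; w] != set0 by apply/set0Pn; exists u;
    rewrite set21.
  have /andP[t0 e0s] := hull_tight spX tT e0.
  have cU0 : 1 < #|U0| by have := subset_leq_card e0s; rewrite cards2 (simple_neq sG eG).
  have [f [fX fU vf]] := deg_tight t0 cU0 vU.
  by rewrite card_gt0; apply/set0Pn; exists f; rewrite inE fX.
by have := dU _ vR; rewrite d3; card_lia.
Qed.

End LocalSearch.

(** * A base of maximum degree at most 2m + 1 *)

Section Bounded.
Variable V : finType.
Implicit Types (x y z u v w : V) (S U P Q W I : {set V}) (e f : {set V}).
Implicit Types (A B E F X Y Z : {set {set V}}).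
Variables (m t : nat) (G : {set {set V}}).
Hypotheses (m_gt0 : 0 < m) (sG : simple G) (tG : nat_tough t G) (ncG : noncomplete G).
Hypothesis t_ge : 2 * m ^ 2 + 2 * m <= t.

Lemma cardXD X S : simple X -> #|X| = #|inside X S| + #|cut X S| + #|inside X (~: S)|.
Proof.
move=> sX; rewrite -!sum1_card big_mkcond [\sum_(e in inside X S) 1]big_mkcond [\sum_(e
  in cut X S) 1]big_mkcond.
rewrite [\sum_(e in inside X (~: S)) 1]big_mkcond -!big_split /=; apply: eq_bigr => e _.
rewrite !inE; case eX: (e \in X) => //=.
have e0 : e != set0 by apply: contraTneq eX => ->; apply/negP => /sX; rewrite cards0.
have -> : (e \subset ~: S) = (e :&: S == set0) by rewrite setI_eq0 disjoints_subset.
case eS: (e \subset S); first by rewrite (setIidPl eS) (negbTE e0).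
by case: eqP.
Qed.

Lemma cut_insideT X (F : {set V}) : cut (inside X F) F = set0.
Proof. by apply/setP=> e; rewrite !inE; case: (e \subset F); rewrite ?andbF. Qed.

Lemma inside_inside X (F : {set V}) P : P \subset F -> inside (inside X F) P = inside X P.
Proof.
move=> sPF; apply/setP=> e; rewrite !inE; case eP: (e \subset P); rewrite ?andbF ?andbT //.
by rewrite (subset_trans eP sPF) andbT.
Qed.

Lemma card_bigcup (I T : finType) (J : {set I}) (A : I -> {set T}) :
  #|\bigcup_(i in J) A i| <= \sum_(i in J) #|A i|.
Proof.
elim/big_rec2: _ => [|i n B _ hn]; first by rewrite cards0.
by apply: leq_trans (leq_card_setU _ _) _; rewrite leq_add2l.
Qed.

(** In a base of least excess, the vertices [S] outside all pieces have degree at least 2m + 1. If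
    one exceeds this, sparsity leaves so few edges between the blocks that deleting [S] and few more
    vertices creates too many components. *)
Lemma bounded_base : exists X, base m G X /\ forall v, deg X v <= 2 * m + 1.
Proof.
have cV := card_noncomplete tG ncG.
have [X0 bX0] : exists X, base m G X.
  apply: base_exists => //; first by lia.
  move=> P P0 PT; have := cut_lb sG tG ncG (S := set0) (P := P).
  by rewrite setC0 insideT subsetT cards0 => /(_ isT P0 PT); lia.
set h := 2 * m + 1.
case: (arg_minnP (excess h) (P := base m G) (i0 := X0) bX0) => X bX minX.
exists X; split=> //; apply/forallP; apply/negPn/negP => /forallPn[v0];
  rewrite -ltnNge => dv0.
have sX := base_simple sG bX; have [sXG spX tX] := and3P bX.
pose pc := piece m h G X; pose B := block pc.
pose F := [set v | [exists P : {set V}, pc P && (v \in P)]]; pose S := ~: F.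
have pU : forall P Q, pc P -> pc Q -> P :&: Q != set0 -> pc (P :|: Q) by exact: (pieceU bX).
have inF v : v \in F -> exists2 P, pc P & v \in P.
  by rewrite inE => /existsP[P /andP[h1 h2]]; exists P.
have pF P : pc P -> P \subset F.
  by move=> pP; apply/subsetP=> v vP; rewrite inE; apply/existsP; exists P; rewrite pP.
have BP v : v \in F -> pc (B v) /\ v \in B v.
  by move=> /inF[P pP vP]; apply/andP; apply: (block_piece pU pP vP).
have BF v : v \in F -> B v \subset F by move=> /BP[/pF].
have Beq u v : v \in F -> u \in B v -> B u = B v.
  by move=> /inF[P pP vP]; apply: (block_eq pU pP vP).
have dS v : v \in S -> h <= deg X v.
  rewrite inE leqNgt; apply: contra => dv; rewrite inE; apply/existsP; exists [set v].
  by rewrite set11 andbT; apply: piece1.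
have v0S : v0 \in S.
  rewrite inE; apply/negP => /inF[P /pieceP[_ d _] /d]; rewrite leqNgt dv0 //.
have crossX u w : u \in F -> w \in F -> [set u; w] \in G -> B u != B w -> [set u; w] \in X.
  move=> uF wF uwG; apply: contraNT => uwX.
  have [pu uu] := BP _ uF; have [pw ww] := BP _ wF.
  have [R [pR uR wR]] := piece_join m_gt0 sG bX minX pu pw uu ww uwG uwX.
  by apply/eqP; rewrite (Beq w u uF) // (subsetP (block_sup pR uR)).
pose D P := #|cut (inside X F) P|.
set p := #|B @: F|.
have sXF : simple (inside X F) by apply: simpleS sX; apply: inside_sub.
have blocks_sum : 2 * #|inside X F| + 2 * m * p = 2 * m * #|F| + \sum_(P in B @: F) D P.
  have := sum_deg F sXF; rewrite cut_insideT cards0 addn0 inside_inside // => <-.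
  have h1 v : v \in F -> v \in B v /\ B v \subset F by move=> vF; split;
    [case: (BP _ vF)|exact: BF].
  have h2 u v : v \in F -> u \in B v -> B u = B v by exact: Beq.
  rewrite (sum_blocks _ h1 h2) -sum1_card (sum_blocks _ h1 h2).
  rewrite /p -sum1_card !big_distrr -!big_split /=; apply: eq_bigr => _ /imsetP[v vF ->].
  rewrite sum_deg // sum1_card inside_inside ?BF //;
    have [/pieceP[/andP[_ /eqP hv] _ _] _] := BP _ vF.
  by rewrite /D -!mulnA; card_lia.
have cardFS : #|S| + #|F| = #|V| by rewrite addnC /S cardsC.
(* Here h = 2m + 1 pays: the vertices of [S] take one degree more each than the 2m that sparsity
   provides on average, so the edges leaving blocks fall short of 2m per block by at least 2|S| + 4m
   + 2 in total. *)
have key : \sum_(P in B @: F) D P + 4 * m + 2 * #|S| + 2 <= 2 * m * p.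
  have e1 := sum_deg S sX; have e2 := cardXD S sX.
  have e3 : h * #|S| + 1 <= \sum_(v in S) deg X v.
    rewrite (bigD1 v0) //= (cardsD1 v0) v0S mulnDr muln1 -addnA addnC addnAC -addnA.
    rewrite addnC; apply: leq_add; first by rewrite addn1.
    rewrite -sum1_card big_distrr /= (eq_bigl (fun v => (v \in S) && (v != v0)));
      last first.
      by move=> v; rewrite !inE andbC.
    by apply: leq_sum => v /andP[/dS]; rewrite muln1.
  have S0 : S != set0 by apply/set0Pn; exists v0.
  have e4 := sparseP _ _ spX _ S0; have e5 := base_card bX.
  rewrite {2}/S setCK in e2.
  have e6 : m * #|V| = m * #|S| + m * #|F| by rewrite -cardFS mulnDr.
  have e7 : h * #|S| = 2 * (m * #|S|) + #|S| by rewrite /h mulnDl mul1n mulnA.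
  rewrite -!mulnA in blocks_sum *; clear - blocks_sum e1 e2 e3 e4 e5 e6 e7.
  by card_lia.
pose L := [set P in B @: F | D P < 2 * m].
(* Blocks outside [L] have their full share 2m, so the whole shortage falls on [L]. *)
have cL : 2 * #|S| + 4 * m + 2 <= 2 * m * #|L|.
  have : 2 * m * #|(B @: F) :\: L| <= \sum_(P in B @: F) D P.
    rewrite -sum1_card big_distrr /= [X in _ <= X](bigID (mem L)) /=.
    apply: leq_trans (leq_addl _ _).
    rewrite (eq_bigl (fun P => (P \in B @: F) && (P \notin L))); last by move=> P;
      rewrite !inE andbC.
    apply: leq_sum => P /andP[PB]; rewrite inE PB /= -leqNgt muln1 //.
  have := cardsID L (B @: F); rewrite (setIidPr _); last by apply/subsetP=> P;
    rewrite inE => /andP[].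
  rewrite -/p => ep; have : 2 * m * p = 2 * m * #|L| + 2 * m * #|B @: F :\: L| by rewrite
    -mulnDr ep.
  by clear - key; card_lia.
pose N P := boundary G (F :\: P) P.
have disB P Q z : P \in B @: F -> Q \in B @: F -> z \in P -> z \in Q -> P = Q.
  by move=> /imsetP[v vF ->] /imsetP[w wF ->] zv zw; rewrite -(Beq z v) // (Beq z w).
have blkF P z : P \in B @: F -> z \in P -> z \in F /\ B z = P.
  by move=> /imsetP[v vF ->] zv; rewrite (subsetP (BF v vF)) // (Beq z v).
have cutE P : P \in B @: F -> between G (F :\: P) P \subset cut (inside X F) P.
  move=> PB; apply/subsetP=> e; rewrite !inE => /and3P[eG /set0Pn[a]].
  rewrite in_setI in_setD => /and3P[ae aP aF] /set0Pn[b]; rewrite in_setI => /andP[be bP].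
  have [bF bB] := blkF _ _ PB bP.
  have [c ca De] := simple_endsx sG eG ae; subst e.
  have ? : b = c by move: be; rewrite in_set2 => /orP[]/eqP // ba;
    rewrite ba (negbTE aP) in bP.
  subst c; rewrite !set2_subset aF bF (negbTE aP) !andbT /=; apply/andP; split.
    apply: crossX => //; rewrite bB; apply: contraNneq aP => <-; by case: (BP _ aF).
  by apply/set0Pn; exists b; rewrite in_setI be.
have inN P z : (z \in N P) = [&& z \notin P, z \in F & [exists w in P, [set z; w] \in G]].
  by rewrite in_set in_setD andbA.
have dN P : P \in B @: F -> #|N P| <= D P.
  move=> PB; apply: leq_trans (subset_leq_card (cutE _ PB)); apply: card_boundary.
  by rewrite disjoints_subset; apply/subsetP=> z; rewrite !inE => /andP[].
have cutN P : P \in B @: F -> #|cut (inside G F) P| <= D P.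
  move=> PB; apply: leq_trans (subset_leq_card (cutE _ PB));
    apply/subset_leq_card/subsetP=> e.
  rewrite !inE -!andbA => /and4P[-> eF -> /subsetPn[z ze zP]]; rewrite andbT.
  by apply/set0Pn; exists z; rewrite !inE ze zP; have := subsetP eF _ ze; rewrite inE.
(* For small [S] a single low block contradicts [cut_lb]; it is not all of [F] because [cL] forces a
   second low block. *)
have [small|large] := leqP (#|S| + 4 * m) (2 * t).
  have [P PL] : exists P, P \in L.
    apply/set0Pn; rewrite -card_gt0 lt0n; apply/eqP => L0; move: cL; rewrite L0 muln0;
      clear; lia.
  have PB : P \in B @: F by move: PL; rewrite inE => /andP[].
  have [v vF Pv] := imsetP PB; have [_ vv] := BP _ vF.
  have PF : P != F.
    apply/eqP => PF; have : #|L| <= 1.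
      apply/card_le1_eqP => Q Q'; have all1 R : R \in L -> R = P.
        rewrite inE => /andP[/imsetP[w wF ->] _]; apply: (disB _ _ w); rewrite ?imset_f //.
          by case: (BP _ wF).
        by rewrite PF.
      by move=> /all1-> /all1->.
    move=> L1; have : 2 * m * #|L| <= 2 * m * 1 by rewrite leq_mul2l L1 orbT.
    by move: cL; clear; card_lia.
  have := cut_lb sG tG ncG (S := S) (P := P); rewrite /S setCK => /(_ _ _ PF) h1.
  have {}h1 : 2 * t <= #|~: F| + 2 * #|cut (inside G F) P|.
    by apply: h1; [rewrite Pv BF|rewrite Pv; apply/set0Pn; exists v].
  have := cutN _ PB; move: PL; rewrite inE => /andP[_]; rewrite -/S in h1.
  by clear - h1 small; card_lia.
(* Many blocks have small boundary.  Deleting [S] and the outer neighbours of a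
   maximal family [J] of such blocks without edges between them separates the
   members of [J], so toughness bounds their number. *)
pose indep (J : {set {set V}}) := [forall P in J, forall Q in J,
  (P != Q) ==> [disjoint P & N Q]].
pose good (J : {set {set V}}) := (J \subset L) && indep J.
have g0 : good set0 by rewrite /good sub0set; apply/forall_inP=> P; rewrite inE.
case: (arg_maxnP (fun J : {set {set V}} => #|J|) g0) => J /andP[sJL iJ] maxJ.
have JB Q : Q \in J -> Q \in B @: F by move/(subsetP sJL); rewrite inE => /andP[].
have JD Q : Q \in J -> #|N Q| <= 2 * m - 1.
  move=> QJ; apply: leq_trans (dN _ (JB _ QJ)) _.
  by move/(subsetP sJL): QJ; rewrite inE => /andP[_]; clear; lia.
have Nsym P Q : P \in B @: F -> Q \in B @: F -> ~~ [disjoint P & N Q] ->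
  ~~ [disjoint Q & N P].
  move=> PB QB /pred0Pn[z /andP[/= zP]]; rewrite inN => /and3P[zQ zF /exists_inP[w wQ zw]].
  apply/pred0Pn; exists w; rewrite /= wQ inN; have [-> wB] := blkF _ _ QB wQ.
  rewrite /=; apply/andP; split.
    by apply: contra zQ => wP; rewrite (disB Q P w).
  by apply/exists_inP; exists z; rewrite // setUC.
have cover : L \subset J :|: \bigcup_(Q in J) B @: N Q.
  apply/subsetP=> P PL; rewrite inE; apply/norP => -[PJ /bigcupP nb].
  have PB : P \in B @: F by move: PL; rewrite inE => /andP[].
  have NJ Q : Q \in J -> [disjoint P & N Q].
    move=> QJ; apply/negPn/negP => /pred0Pn[z /andP[/= zP zN]]; apply: nb; exists Q => //.
    by apply/imsetP; exists z => //; have [_ ->] := blkF _ _ PB zP.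
  have NJ' Q : Q \in J -> [disjoint Q & N P].
    move=> QJ; apply/negPn/negP => /(Nsym _ _ (JB _ QJ) PB); rewrite NJ //.
  have := maxJ (P |: J); rewrite cardsU1 PJ /= /good subUset sub1set PL sJL /=.
  suff -> : indep (P |: J) by move/(_ isT); clear; card_lia.
  apply/forall_inP => Q1; rewrite in_setU1 => /orP[/eqP->|Q1J]; apply/forall_inP => Q2;
    rewrite in_setU1 => /orP[/eqP->|Q2J]; apply/implyP => ne; rewrite ?eqxx // in ne *.
  - exact: NJ.
  - exact: NJ'.
  - by have := forall_inP (forall_inP iJ _ Q1J) _ Q2J; rewrite ne.
(* By maximality a low block outside [J] contains an outer neighbour of a member of [J]; a member
   has at most 2m - 1 of them, each in one block. *)
have cLJ : #|L| <= 2 * m * #|J|.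
  apply: leq_trans (subset_leq_card cover) _; apply: leq_trans (leq_card_setU _ _) _.
  have h1 : #|\bigcup_(Q in J) B @: N Q| <= \sum_(Q in J) (2 * m - 1).
    apply: leq_trans (card_bigcup _ _) _; apply: leq_sum => Q QJ.
    exact: leq_trans (leq_imset_card _ _) (JD _ QJ).
  rewrite sum_nat_const in h1.
  have : 2 * m * #|J| = #|J| + #|J| * (2 * m - 1) by clear - m_gt0; nia.
  by move: h1; clear; card_lia.
pose rep (P : {set V}) := odflt v0 [pick z in P].
have repP Q : Q \in J -> rep Q \in Q.
  move=> QJ; rewrite /rep; case: pickP => // Q0; have /imsetP[v vF Qv] := JB _ QJ.
  by have := Q0 v; rewrite Qv; case: (BP _ vF) => _ ->.
pose S' := S :|: \bigcup_(Q in J) N Q.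
have repE P Q : P \in J -> Q \in J -> rep P \in Q -> P = Q.
  by move=> PJ QJ; apply: disB (repP _ PJ); apply: JB.
have cI : #|rep @: J| = #|J|.
  apply: card_in_imset => P Q PJ QJ E; apply: repE => //; rewrite E; exact: repP.
have repS' Q : Q \in J -> rep Q \notin S'.
  move=> QJ; have [rF _] := blkF _ _ (JB _ QJ) (repP _ QJ).
  rewrite in_setU negb_or in_setC negbK rF; apply/bigcupP => -[P PJ].
  have [->|ne] := eqVneq P Q; first by rewrite inN repP.
  have := forall_inP (forall_inP iJ _ QJ) _ PJ; rewrite eq_sym ne => /disjointFr -> //;
    exact: repP.
have cS' : #|S'| <= #|S| + #|J| * (2 * m - 1).
  apply: leq_trans (leq_card_setU _ _) _; rewrite leq_add2l -sum_nat_const.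
  by apply: leq_trans (card_bigcup _ _) _; apply: leq_sum => Q /JD.
have [||J1|tJ] := tG (S := S') (I := rep @: J).
- by apply/subsetP=> _ /imsetP[Q QJ ->]; rewrite in_setC repS'.
- move=> _ _ /imsetP[P PJ ->] /imsetP[Q QJ ->] cPQ; congr rep; apply/esym/repE => //.
  rewrite -(@conn_invariant _ _ bool (fun z => z \in P) _ _ _ cPQ) ?repP //.
  have half x y : x \notin S' -> y \notin S' -> [set x; y] \in G -> x \in P -> y \in P.
    move=> xS yS xyG xP; apply: contraNT yS => yP.
    rewrite in_setU; case yS: (y \in S) => //=; apply/bigcupP; exists P => //.
    rewrite inN yP; move: yS; rewrite in_setC => /negbFE -> /=.
    by apply/exists_inP; exists x; rewrite // setUC.
  move=> x y; rewrite in_inside set2_subset !in_setC => /and3P[xyG xS yS].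
  by apply/idP/idP; apply: half => //; rewrite setUC.
- rewrite cI in J1; have : 2 * m * #|L| <= 2 * m * (2 * m * 1).
    by rewrite leq_mul2l (leq_trans cLJ) ?orbT // leq_mul2l J1 orbT.
  have E : 2 * m * (2 * m * 1) = 2 * (2 * m ^ 2) by rewrite expnS expn1; clear; lia.
  have t_ge' := t_ge; rewrite E; move: cL large t_ge'; clear; move: (m ^ 2) => mm; card_lia.
(* From [cL] and [cLJ], |S| < 2m^2 |J|, so toughness would give t|J| < (2m^2 + 2m)|J|: the origin of
   [t_ge]. *)
rewrite cI in tJ; have h1 : t * #|J| <= #|S| + #|J| * (2 * m - 1) by apply: leq_trans tJ
  cS'.
have h2 : 2 * m * #|L| <= 2 * m * (2 * m * #|J|) by rewrite leq_mul2l cLJ orbT.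
have h3 : (2 * m ^ 2 + 2 * m) * #|J| <= t * #|J| by rewrite leq_mul2r t_ge orbT.
have h4 : #|J| * (2 * m - 1) <= 2 * m * #|J| by rewrite mulnC leq_mul2r leq_subr orbT.
have h5 : 2 * m * (2 * m * #|J|) = 2 * (2 * m ^ 2 * #|J|).
  by rewrite expnS expn1; clear; move: #|_| => j; lia.
rewrite mulnDl in h3; move: cL h1 h2 h3 h4; rewrite h5; clear.
by card_lia.
Qed.

End Bounded.

(** * Packing spanning trees *)

Section NashWilliams.
Variable V : finType.
Implicit Types (x y z u v w : V) (S U P Q W I : {set V}) (e f : {set V}).
Implicit Types (A B E F Y Z : {set {set V}}).

Lemma conn_inside F U u v : (forall x y, [set x; y] \in F -> x \in U -> y \in U) ->
  u \in U -> conn F u v -> conn (inside F U) u v.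
Proof.
move=> hU uU; pose r x y := (x \in U) ==> (y \in U) && conn (inside F U) x y.
suff h : forall x y, conn F x y -> r x y by move=> /h; rewrite /r uU => /andP[].
apply: conn_sub.
- by move=> x; apply/implyP=> xU; rewrite xU conn_refl.
- move=> y x z /implyP hxy /implyP hyz; apply/implyP => /hxy/andP[/hyz/andP[-> c2] c1] /=.
  exact: conn_trans c1 c2.
move=> x y xyF; apply/implyP => xU; have yU := hU _ _ xyF xU; rewrite yU /=.
by apply: conn1; rewrite in_inside xyF set2_subset xU yU.
Qed.

(** The vertices of [U] share one class, so there are at most 1 + |V| - |U| classes; [nclasses_lb]
    gives at least |V| - |F|. *)
Lemma connected_card F U u : simple F -> u \in U -> (forall v, v \in U -> conn F u v) ->
  #|U| <= #|F| + 1.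
Proof.
move=> sF uU hU; have lb := nclasses_lb sF.
have sub : [set conn_class F v | v : V] \subset conn_class F u |: (conn_class F @: ~: U).
  apply/subsetP=> _ /imsetP[v _ ->]; rewrite in_setU1; case vU: (v \in U).
    by rewrite conn_class_eq conn_sym hU.
  by rewrite imset_f ?orbT // inE vU.
have := subset_leq_card sub; rewrite -/(nclasses F) cardsU1 => h1.
have := leq_imset_card (conn_class F) (mem (~: U)); have := cardsC U.
by move: lb h1; case: (_ \notin _) => /=; clear; card_lia.
Qed.

Variables (m : nat) (X : {set {set V}}).
Hypotheses (sX : simple X) (spX : sparse m X).

Local Notation coloring := {ffun 'I_m -> {set {set V}}}.
Implicit Types (phi psi : coloring).

Definition forestb F := [forall u, forall v, ([set u; v] \in F) ==> ~~ conn (F :\ [set u;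
  v]) u v].

Lemma forestP F : reflect (forest F) (forestb F).
Proof.
apply: (iffP forallP) => h u; first by move=> v; apply/implyP; apply: (forallP (h u)).
by apply/forallP=> v; apply/implyP; apply: h.
Qed.

Definition packing phi := [forall i, (phi i \subset X) && forestb (phi i)] &&
  [forall i, forall j, (i != j) ==> [disjoint phi i & phi j]].

Lemma packingP phi : reflect [/\ forall i, phi i \subset X, forall i, forest (phi i) &
  forall i j, i != j -> [disjoint phi i & phi j]] (packing phi).
Proof.
apply: (iffP andP) => [[/forallP h1 /forallP h2]|[h1 h2 h3]]; split.
- by move=> i; case/andP: (h1 i).
- by move=> i; apply/forestP; case/andP: (h1 i).
- by move=> i j; apply/implyP; apply: (forallP (h2 i)).
- by apply/forallP=> i; rewrite h1; apply/forestP.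
- by apply/forallP=> i; apply/forallP=> j; apply/implyP; apply: h3.
Qed.

Definition uncolored phi e := (e \in X) && [forall i, e \notin phi i].

Definition recolor phi i A : coloring := [ffun j => if j == i then A else phi j].

(** The exchange of matroid union: an uncoloured edge enters a colour class and pushes out [f],
    which becomes uncoloured. *)
Definition step phi psi := packing psi && [exists i, [exists e, [exists f,
  [&& uncolored phi e, f \in phi i & psi == recolor phi i (e |: (phi i :\ f))]]]].

Definition packing_size phi := \sum_i #|phi i|.

Lemma size_recolor phi i A : packing_size (recolor phi i A) + #|phi i| = packing_size phi
  + #|A|.
Proof.
rewrite /packing_size (bigD1 i) //= [in RHS](bigD1 i) //= ffunE eqxx.
rewrite (eq_bigr (fun j => #|phi j|)); last by move=> j ji; rewrite ffunE (negbTE ji).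
by rewrite addnC addnA addnAC.
Qed.

Lemma stepP phi psi : step phi psi -> packing psi /\ packing_size psi = packing_size phi.
Proof.
case/andP=> -> /existsP[i /existsP[e /existsP[f /and3P[/andP[_ /forallP he] fi /eqP->]]]].
split=> //; have := size_recolor phi i (e |: (phi i :\ f)).
have := he i; rewrite cardsU1 (cardsD1 f (phi i)) fi !inE => /negbTE ->; rewrite andbF /=.
by card_lia.
Qed.

Variable phi0 : coloring.
Hypotheses (pk0 : packing phi0) (max0 : forall phi, packing phi ->
  packing_size phi <= packing_size phi0).

Lemma reachP phi : connect step phi0 phi ->
  packing phi /\ packing_size phi = packing_size phi0.
Proof.
case/connectP=> s; elim: s phi0 pk0 => [|a s IHs] b pb /=; first by move=> _ ->.
by case/andP=> /stepP[pa sa] ps /(IHs _ pa ps)[-> ->].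
Qed.

(* Whether two vertices are connected by freed edges of a given colour does not
   change under exchanges. *)
Definition freed := [set e | [exists phi, connect step phi0 phi && uncolored phi e]].

Lemma freedI phi e : connect step phi0 phi -> uncolored phi e -> e \in freed.
Proof. by move=> h1 h2; rewrite inE; apply/existsP; exists phi; rewrite h1. Qed.

Lemma recolor_packing phi i A x y : packing phi -> A \subset phi i ->
  uncolored phi [set x; y] ->
  ~~ conn A x y -> packing (recolor phi i ([set x; y] |: A)).
Proof.
move=> /packingP[h1 h2 h3] sA /andP[eX /forallP ne] nc; have xy := simple_neq sX eX.
apply/packingP; split=> j; rewrite ?ffunE.
- by case: eqP => // _; rewrite subUset sub1set eX (subset_trans sA).
- by case: eqP => // _; apply: forestU1 => //; apply: forestS (h2 i).
move=> k jk; rewrite !ffunE.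
have half l : l != i -> [disjoint [set x; y] |: A & phi l].
  move=> li; rewrite disjoints_subset subUset sub1set in_setC ne /=.
  by rewrite -disjoints_subset; apply: disjointWl sA _; apply: h3; rewrite eq_sym.
case: (eqVneq j i) => [ji|ji]; case: (eqVneq k i) => [ki|ki].
- by rewrite ji ki eqxx in jk.
- exact: half.
- by rewrite disjoint_sym; apply: half.
- exact: h3.
Qed.

Lemma uncolored_conn phi i x y : packing phi -> packing_size phi = packing_size phi0 ->
  uncolored phi [set x; y] -> conn (phi i) x y.
Proof.
move=> pk sz un; apply/negPn/negP => nc.
have := max0 (recolor_packing pk (subxx _) un nc).
have := size_recolor phi i ([set x; y] |: phi i); case/andP: un => _ /forallP/(_ i) ne.
by rewrite cardsU1 ne sz; card_lia.
Qed.

(** A minimal subset of [phi i] joining [x] to [y] is the tree path. Each of its edges can be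
    exchanged for the uncoloured edge, hence is freed. *)
Lemma uncolored_freed phi i x y : connect step phi0 phi ->
  uncolored phi [set x; y] -> conn (phi i :&: freed) x y.
Proof.
move=> rphi un; have [pk sz] := reachP rphi.
pose joins (Q : {set {set V}}) := (Q \subset phi i) && conn Q x y.
have c0 : joins (phi i).
  by rewrite /joins subxx (uncolored_conn _ pk sz un).
case: (arg_minnP (fun Q : {set {set V}} => #|Q|) c0) => Q /andP[sQ cQ] minQ.
apply: (connW _ cQ); apply/subsetP=> f fQ; rewrite inE (subsetP sQ) //=.
have /packingP[h1 h2 h3] := pk; have sphi : simple (phi i) by apply: simpleS sX.
have sQs : simple Q by apply: simpleS sphi.
have nQ : ~~ conn (Q :\ f) x y.
  apply/negP => c; have := minQ (Q :\ f);
    rewrite /joins c (subset_trans (subsetDl _ _) sQ) => /(_ isT).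
  by rewrite [#|Q|](cardsD1 f) fQ /=; card_lia.
have [p [q [Df [c1 c2]]]] := conn_cut sQs fQ cQ nQ.
have sub : Q :\ f \subset phi i :\ f by apply: setSD.
have nphi : ~~ conn (phi i :\ f) x y.
  apply/negP => c; have : [set p; q] \in phi i by rewrite -Df (subsetP sQ).
  move/(h2 i)/negP; apply; rewrite -Df.
  apply: conn_trans (connW sub _) (conn_trans c (connW sub _));
    first by rewrite conn_sym; exact: c1.
  by rewrite conn_sym.
have pk' := recolor_packing pk (subsetDl _ _) un nphi.
apply: (freedI (phi := recolor phi i ([set x; y] |: (phi i :\ f)))).
  apply: connect_trans rphi (connect1 _); rewrite /step pk' /=.
  apply/existsP; exists i; apply/existsP; exists [set x; y]; apply/existsP; exists f.
  by rewrite un (subsetP sQ) //=.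
have fphi := subsetP sQ _ fQ.
rewrite /uncolored (subsetP (h1 i)) //=; apply/forallP=> j; rewrite ffunE.
case: (eqVneq j i) => [_|ji].
  rewrite !inE eqxx /= orbF; apply: contraTneq fphi => ->; by case/andP: un => _ /forallP.
by apply/negP => fj; have := disjointFr (h3 _ _ ji) fj; rewrite fphi.
Qed.

(** The entering and the leaving edge are both freed, so by [uncolored_freed] the exchange takes
    place among the freed edges of the colour, where [conn_exchange] applies. *)
Lemma step_conn phi psi i : connect step phi0 phi -> step phi psi ->
  conn (psi i :&: freed) =2 conn (phi i :&: freed).
Proof.
move=> rphi st; have rpsi : connect step phi0 psi by apply: connect_trans rphi (connect1
  st).
have [pk sz] := reachP rphi; have [pk' _] := reachP rpsi.
have /packingP[h1 h2 h3] := pk; have /packingP[_ h2' _] := pk'.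
case/andP: st => _ /existsP[j /existsP[e /existsP[f /and3P[un fj /eqP Dpsi]]]].
have [ij|ij] := eqVneq i j; last by move=> x y; rewrite Dpsi ffunE (negbTE ij).
subst j; have [x [y [xy De]]] := simple_ends sX (proj1 (andP un)); subst e.
have eR : [set x; y] \in freed by apply: freedI un.
have Ei : psi i = [set x; y] |: (phi i :\ f) by rewrite Dpsi ffunE eqxx.
have nei : [set x; y] \notin phi i by case/andP: un => _ /forallP.
have fe : f != [set x; y] by apply: contraNneq nei => <-.
have fR : f \in freed.
  apply: (freedI rpsi); rewrite /uncolored (subsetP (h1 i)) //=; apply/forallP=> k;
    rewrite Dpsi ffunE.
  case: (eqVneq k i) => [_|ki]; first by rewrite !inE eqxx (negbTE fe).
  by apply/negP => fk; have := disjointFr (h3 _ _ ki) fk; rewrite fj.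
have -> : psi i :&: freed = [set x; y] |: ((phi i :&: freed) :\ f).
  rewrite Ei; apply/setP=> g; rewrite !(in_setI, in_setU1, in_setD1).
  by case: eqP => [->|_] /=; rewrite ?eR ?andbA.
have cA := uncolored_freed i rphi un.
have fA : f \in phi i :&: freed by rewrite inE fj.
have nA : ~~ conn ((phi i :&: freed) :\ f) x y.
  have := h2' i x y; rewrite Ei setU11 => /(_ isT); apply: contra; apply: connW.
  by apply/subsetP=> g; rewrite !inE => /and3P[-> gi _]; rewrite gi /= orbT andbT;
    apply: contraNneq nei => <-.
have sA : simple (phi i :&: freed) by apply: simpleS sX; apply: subset_trans (h1 i);
  apply: subsetIl.
exact: conn_exchange sA (erefl _) fA cA nA.
Qed.

Lemma reach_conn phi i : connect step phi0 phi ->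
  conn (phi i :&: freed) =2 conn (phi0 i :&: freed).
Proof.
case/connectP=> s; elim/last_ind: s phi => [|s psi IHs] phi; first by move=> _ ->.
rewrite rcons_path last_rcons => /andP[ps st] -> x y.
by rewrite (step_conn i _ st) ?(IHs _ ps erefl) //; apply/connectP; exists s.
Qed.

(** Let [U] be the component of an uncoloured edge in the graph of freed edges. Every colour
    connects [U] by freed edges and so has at least |U| - 1 edges inside; together with the
    uncoloured edge they exceed m(|U| - 1). *)
Lemma all_colored e : e \in X -> exists i, e \in phi0 i.
Proof.
move=> eX; apply/existsP; have [//|/existsPn ne] := boolP [exists i, e \in phi0 i]; exfalso.
have un : uncolored phi0 e by rewrite /uncolored eX; apply/forallP.
have /packingP[h1 h2 h3] := pk0.
have [u [w [uw De]]] := simple_ends sX eX.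
have conn_all i x y : [set x; y] \in freed -> conn (phi0 i :&: freed) x y.
  rewrite inE => /existsP[phi /andP[rphi unphi]].
  by rewrite -(reach_conn i rphi); apply: uncolored_freed.
pose U := conn_class freed u.
have clU x y : [set x; y] \in freed -> x \in U -> y \in U.
  by move=> xyF; rewrite !inE => /conn_trans; apply; apply: conn1.
have eF : [set u; w] \in freed by rewrite -De; apply: freedI un.
have uU : u \in U by rewrite inE conn_refl.
pose A i := inside (phi0 i :&: freed) U.
have cA i : #|U| <= #|A i| + 1.
  apply: (connected_card (u := u)) => //.
    by apply: simpleS sX; apply: subset_trans (inside_sub _ _) (subset_trans (subsetIl _
      _) (h1 i)).
  move=> v; rewrite inE => cuv; apply: conn_inside => //; first by move=> x y;
    rewrite inE => /andP[_]; apply: clU.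
  move: cuv; apply: conn_sub; [exact: conn_refl|by move=> ? ? ?;
    apply: conn_trans|exact: conn_all].
have dA i j : i != j -> [disjoint A i & A j].
  move=> ij; apply: disjointWl (disjointWr _ (h3 _ _ ij)).
    by apply: subset_trans (inside_sub _ _) (subsetIl _ _).
  by apply: subset_trans (inside_sub _ _) (subsetIl _ _).
have sub : e |: \bigcup_i A i \subset inside X U.
  rewrite subUset sub1set in_inside eX De set2_subset uU (clU _ _ eF uU) /=.
  apply/bigcupsP=> i _; apply/subsetP=> g; rewrite !inE => /andP[/andP[gi _] ->].
  by rewrite (subsetP (h1 i)).
have := subset_leq_card sub; rewrite cardsU1.
have -> : e \notin \bigcup_i A i.
  by apply/bigcupP => -[i _]; rewrite !inE => /andP[/andP[ei _] _];
    case/andP: un => _ /forallP/(_ i); rewrite ei.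
have -> : #|\bigcup_i A i| = \sum_i #|A i|.
  rewrite -sum1_card partition_disjoint_bigcup //; by apply: eq_bigr => i _;
    rewrite sum1_card.
have U0 : U != set0 by apply/set0Pn; exists u.
have := sparseP _ _ spX _ U0.
have : m * #|U| <= \sum_i #|A i| + m.
  have -> : m * #|U| = \sum_(i < m) #|U| by rewrite sum_nat_const card_ord.
  apply: (@leq_trans (\sum_(i < m) (#|A i| + 1))); first exact: leq_sum.
  by rewrite big_split /= sum_nat_const card_ord muln1.
by clear; card_lia.
Qed.

End NashWilliams.

(** A maximal packing colours all m(|V| - 1) edges, which leaves one component for each of the [m]
    forests. *)
Lemma nash_williams (V : finType) m (X : {set {set V}}) :
  simple X -> sparse m X -> tight m X setT ->
  exists T : 'I_m -> {set {set V}}, [/\ forall i, T i \subset X,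
    forall i j, i != j -> [disjoint T i & T j] & forall i, spans (T i)].
Proof.
move=> sX spX /andP[V0 /eqP tX]; rewrite insideT cardsT in tX;
  rewrite -card_gt0 cardsT in V0.
pose empty : {ffun 'I_m -> {set {set V}}} := [ffun=> set0].
have pk : packing X empty.
  apply/packingP; split=> [i|i u v|i j _]; rewrite !ffunE ?sub0set ?inE //.
  by rewrite disjoints_subset sub0set.
case: (arg_maxnP (@packing_size V m) pk) => phi pphi maxphi.
have all := all_colored sX spX pphi maxphi.
have /packingP[h1 h2 h3] := pphi.
exists phi; split; [exact: h1|exact: h3|move=> i]; apply: nclasses_spans; rewrite leqNgt;
  apply/negP => ni.
have sphi j : simple (phi j) by apply: simpleS (h1 j) sX.
have nc j : 0 < nclasses (phi j).
  have /card_gt0P[v _] := V0; rewrite card_gt0; apply/set0Pn;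
    exists (conn_class (phi j) v); exact: imset_f.
have DX : X = \bigcup_j phi j.
  apply/eqP; rewrite eqEsubset; apply/andP; split; last by apply/bigcupsP => j _; apply: h1.
  by apply/subsetP=> e /all[j ej]; apply/bigcupP; exists j.
have cX : #|X| = \sum_j #|phi j|.
  rewrite {1}DX -sum1_card partition_disjoint_bigcup //; by apply: eq_bigr => j _;
    rewrite sum1_card.
have b j : #|phi j| + nclasses (phi j) <= #|V| by rewrite addnC; apply: forest_nclasses;
  [apply: sphi|apply: h2].
have : \sum_j (#|phi j| + nclasses (phi j)) <= m * #|V|.
  have -> : m * #|V| = \sum_(i < m) #|V| by rewrite sum_nat_const card_ord.
  exact: leq_sum.
have : m + 1 <= \sum_j nclasses (phi j).
  apply: (@leq_trans (\sum_(j < m) 1 + 1)); first by rewrite sum_nat_const card_ord muln1.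
  rewrite (bigD1 i) //= [X in _ <= X](bigD1 i) //= addnAC leq_add //; exact: leq_sum.
rewrite big_split /= -cX; move: (\sum_j nclasses _) tX => s; clear; card_lia.
Qed.

(** * Degree constrained subgraphs *)

Section DegreeConstrained.
Variable V : finType.
Implicit Types (x y z v : V) (A B : {set V}) (p q : V * V) (M N : {set V * V}).

(** An arc [(x, y)] stands for the edge from the left copy of [x] to the right copy of [y] in the
    double cover. *)
Definition outdeg M x := #|[set p in M | p.1 == x]|.
Definition indeg M y := #|[set p in M | p.2 == y]|.

Lemma outdegE M x : outdeg M x = \sum_(p in M) (p.1 == x).
Proof. exact: card_setE. Qed.

Lemma indegE M y : indeg M y = \sum_(p in M) (p.2 == y).
Proof. exact: card_setE. Qed.

Lemma sum_eq_mem A x : \sum_(z in A) (x == z) = (x \in A).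
Proof.
have [xA|xA] := boolP (x \in A).
  by rewrite (bigD1 x) //= eqxx big1 // => z /andP[_ zx]; rewrite eq_sym (negbTE zx).
by rewrite big1 // => z zA; case: eqP => // E; rewrite E zA in xA.
Qed.

Lemma sum_outdeg M A : \sum_(x in A) outdeg M x = #|[set p in M | p.1 \in A]|.
Proof.
under eq_bigr do rewrite outdegE;
  rewrite exchange_big -sum1_card big_mkcond /= [RHS]big_mkcond.
by apply: eq_bigr => p _; rewrite inE sum_eq_mem; case: (p \in M) => //=; case: (_ \in _).
Qed.

Lemma sum_indeg M A : \sum_(x in A) indeg M x = #|[set p in M | p.2 \in A]|.
Proof.
under eq_bigr do rewrite indegE;
  rewrite exchange_big -sum1_card big_mkcond /= [RHS]big_mkcond.
by apply: eq_bigr => p _; rewrite inE sum_eq_mem; case: (p \in M) => //=; case: (_ \in _).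
Qed.

Lemma sum_outdegT M : \sum_x outdeg M x = #|M|.
Proof.
rewrite (eq_bigl [in [set: V]]) => [|x]; last by rewrite in_setT.
by rewrite (sum_outdeg _ setT); apply: eq_card => p; rewrite !inE andbT.
Qed.

Lemma sum_indegT M : \sum_x indeg M x = #|M|.
Proof.
rewrite (eq_bigl [in [set: V]]) => [|x]; last by rewrite in_setT.
by rewrite (sum_indeg _ setT); apply: eq_card => p; rewrite !inE andbT.
Qed.

Lemma outdegU1 M p x : p \notin M -> outdeg (p |: M) x = (p.1 == x) + outdeg M x.
Proof. by move=> pM; rewrite !outdegE big_setU1. Qed.

Lemma indegU1 M p x : p \notin M -> indeg (p |: M) x = (p.2 == x) + indeg M x.
Proof. by move=> pM; rewrite !indegE big_setU1. Qed.

Lemma outdegD1 M p x : p \in M -> outdeg M x = (p.1 == x) + outdeg (M :\ p) x.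
Proof. by move=> pM; rewrite !outdegE (big_setD1 p). Qed.

Lemma indegD1 M p x : p \in M -> indeg M x = (p.2 == x) + indeg (M :\ p) x.
Proof. by move=> pM; rewrite !indegE (big_setD1 p). Qed.

Variables (arcs : {set V * V}) (g : V -> nat).

Definition admissible M := [&& M \subset arcs, [forall x, outdeg M x <= g x] & [forall y,
  indeg M y <= g y]].

Lemma admissibleP M : reflect [/\ M \subset arcs, forall x, outdeg M x <= g x & forall y,
  indeg M y <= g y]
  (admissible M).
Proof. by apply: (iffP and3P) => -[h1 h2 h3]; split=> //; apply/forallP. Qed.

(** Two consecutive edges of an alternating path: [y] changes its left partner from [x'] to [x], and
    slack moves from [x] to [x']. *)
Definition shift M x x' y := (x, y) |: (M :\ (x', y)).

Definition shiftable M x x' y :=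
  [&& outdeg M x < g x, (x, y) \in arcs, (x, y) \notin M & (x', y) \in M].

Definition shift_step M N := [exists x, exists x', exists y,
  shiftable M x x' y && (N == shift M x x' y)].

Lemma shift_stepP M N : reflect (exists x x' y,
  shiftable M x x' y /\ N = shift M x x' y) (shift_step M N).
Proof.
apply: (iffP existsP) => [[x /existsP[x' /existsP[y /andP[h /eqP->]]]]|[x [x' [y [h ->]]]]].
  by exists x, x', y.
by exists x; apply/existsP; exists x'; apply/existsP; exists y; rewrite h eqxx.
Qed.

Section Shift.
Variables (M : {set V * V}) (x x' y : V).
Hypothesis sh : shiftable M x x' y.

Lemma shift_outdeg z : (x' == z) + outdeg (shift M x x' y) z = (x == z) + outdeg M z.
Proof.
have /and4P[_ _ h1 h2] := sh; rewrite outdegU1 /=; last by rewrite !inE (negbTE h1) andbF.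
by rewrite [outdeg M z](outdegD1 _ h2) /= addnCA.
Qed.

Lemma shift_indeg z : indeg (shift M x x' y) z = indeg M z.
Proof.
have /and4P[_ _ h1 h2] := sh; rewrite indegU1 /=; last by rewrite !inE (negbTE h1) andbF.
by rewrite [indeg M z](indegD1 _ h2).
Qed.

Lemma shift_card : #|shift M x x' y| = #|M|.
Proof.
have /and4P[_ _ h1 h2] := sh.
by rewrite cardsU1 [#|M|](cardsD1 (x', y)) h2 !inE (negbTE h1) andbF.
Qed.

Lemma shift_neq : x != x'.
Proof. by have /and4P[_ _ h1 h2] := sh; apply: contraNneq h1 => ->. Qed.

Lemma shift_admissible : admissible M -> admissible (shift M x x' y).
Proof.
have /and4P[h0 ha h1 h2] := sh => /admissibleP[s o i]; apply/admissibleP; split.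
- by rewrite subUset sub1set ha (subset_trans (subsetDl _ _)).
- move=> z; have := shift_outdeg z; have := o z.
  by case: (eqVneq x z) h0 => [->|_]; case: (_ == _) => /=; clear; lia.
by move=> z; rewrite shift_indeg.
Qed.

End Shift.

Variable M0 : {set V * V}.
Hypotheses (ad0 : admissible M0) (max0 : forall M, admissible M -> #|M| <= #|M0|).

Let reach := connect shift_step M0.

Lemma reach_admissible M : reach M ->
  [/\ admissible M, #|M| = #|M0| & forall z, indeg M z = indeg M0 z].
Proof.
case/connectP=> s; elim/last_ind: s M => [|s N IHs] M; first by move=> _ ->.
rewrite rcons_path last_rcons => /andP[ps st] ->; have [a c i] := IHs _ ps erefl.
have /shift_stepP[x [x' [y [sh ->]]]] := st; split.
- exact: shift_admissible.
- by rewrite shift_card.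
by move=> z; rewrite shift_indeg.
Qed.

Definition slack_out := [set x | [exists M, connect shift_step M0 M && (outdeg M x < g x)]].

Definition slack_in := [set y | [exists M, exists x, [&& connect shift_step M0 M,
  outdeg M x < g x,
  (x, y) \in arcs & (x, y) \notin M]]].

Lemma slack_outP x : reflect (exists2 M,
  connect shift_step M0 M & outdeg M x < g x) (x \in slack_out).
Proof.
by rewrite inE; apply: (iffP existsP) => [[M /andP[]]|[M h1 h2]]; exists M => //;
  rewrite h1.
Qed.

Lemma slack_inP y : reflect (exists M x, [/\ connect shift_step M0 M, outdeg M x < g x,
  (x, y) \in arcs & (x, y) \notin M]) (y \in slack_in).
Proof.
rewrite inE; apply: (iffP existsP) => [[M /existsP[x /and4P[]]]|[M [x [h1 h2 h3 h4]]]].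
  by exists M, x.
by exists M; apply/existsP; exists x; apply/and4P.
Qed.

(** Otherwise adding [(x, y)] would produce an admissible set larger than [M0]. *)
Lemma slack_in_saturated M x y : connect shift_step M0 M -> outdeg M x < g x ->
  (x, y) \in arcs ->
  (x, y) \notin M -> indeg M y = g y.
Proof.
move=> r o xy nxy; have [/admissibleP[s oM iM] c _] := reach_admissible r.
apply/eqP; rewrite eqn_leq iM leqNgt; apply/negP => iy.
have := max0 (M := (x, y) |: M); rewrite cardsU1 nxy c ltnn => /(_ _)/negP; apply=> //.
apply/admissibleP; split.
- by rewrite subUset sub1set xy.
- by move=> z; rewrite outdegU1 //=; case: (eqVneq x z) => [<-|_]; rewrite ?add1n ?add0n.
by move=> z; rewrite indegU1 //=; case: (eqVneq y z) => [<-|_]; rewrite ?add1n ?add0n.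
Qed.

Lemma slack_in_slack_out M x x' y : connect shift_step M0 M -> outdeg M x < g x ->
  (x, y) \in arcs ->
  (x, y) \notin M -> (x', y) \in M -> x' \in slack_out.
Proof.
move=> r o xy nxy x'y; have [/admissibleP[s oM iM] c _] := reach_admissible r.
have sh : shiftable M x x' y by apply/and4P.
apply/slack_outP; exists (shift M x x' y).
  by apply: connect_trans r (connect1 _); apply/shift_stepP; exists x, x', y.
have := shift_outdeg sh x'; have := oM x'; rewrite eqxx (negbTE (shift_neq sh)) /=; lia.
Qed.

Lemma reach_invariant M x y : connect shift_step M0 M ->
  ~~ ((x \in slack_out) && (y \in slack_in)) ->
  ((x, y) \in M) = ((x, y) \in M0).
Proof.
move=> + nxy; case/connectP=> s; elim/last_ind: s M => [|s N IHs] M; first by move=> _ ->.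
rewrite rcons_path last_rcons => /andP[ps st] ->.
rewrite -(IHs _ ps erefl); have /shift_stepP[z [z' [w [sh ->]]]] := st.
have r : connect shift_step M0 (last M0 s) by apply/connectP; exists s.
have /and4P[h0 ha h1 h2] := sh.
have zo : z \in slack_out by apply/slack_outP; exists (last M0 s).
have wi : w \in slack_in by apply/slack_inP; exists (last M0 s), z.
have zo' : z' \in slack_out by apply: slack_in_slack_out r h0 ha h1 h2.
rewrite !inE; have -> : ((x, y) == (z, w)) = false.
  by apply: contraNF nxy => /eqP[-> ->]; rewrite zo.
suff -> : (x, y) != (z', w) by [].
by apply: contraNneq nxy => -[-> ->]; rewrite zo'.
Qed.

End DegreeConstrained.

(* Ore's theorem for the bipartite double cover. *)
Lemma ore (V : finType) (arcs : {set V * V}) (g : V -> nat) :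
  (forall A B : {set V}, \sum_(x in A) g x <=
    \sum_(y in B) g y + #|[set p in arcs | (p.1 \in A) && (p.2 \notin B)]|) ->
  exists2 M : {set V * V}, M \subset arcs & forall v, outdeg M v = g v /\ indeg M v = g v.
Proof.
move=> hall; have ad : admissible arcs g set0.
  by apply/admissibleP; split; [exact: sub0set| |] => x; rewrite (outdegE, indegE) big_set0.
case: (arg_maxnP (fun M : {set V * V} => #|M|) ad) => M adM maxM.
have /admissibleP[sM oM iM] := adM.
have AP := slack_outP arcs g M; have BP := slack_inP arcs g M.
have outA := @slack_in_slack_out _ arcs g M adM;
  have inv := @reach_invariant _ arcs g M adM.
set A := slack_out arcs g M in AP outA inv; set B := slack_in arcs g M in BP inv.
clearbody A B.
have full x : outdeg M x = g x.
  apply/eqP; rewrite eqn_leq oM leqNgt; apply/negP => ox.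
  have xA : x \in A by apply/AP; exists M => //; apply: connect0.
  have lt : \sum_(z in A) outdeg M z < \sum_(z in A) g z.
    rewrite (bigD1 x) //= [X in _ < X](bigD1 x) //= -addSn leq_add //.
    exact: leq_sum.
  (* Arcs of [M] into [B] start in [A], all arcs from [A] to the outside of [B] lie in [M], and [B]
     is saturated. So the right side is at most the sum of the out-degrees over [A], which is too
     small. *)
  have := hall A B; rewrite leqNgt => /negP; apply; apply: leq_ltn_trans lt.
  rewrite sum_outdeg.
  have -> : \sum_(y in B) g y = \sum_(y in B) indeg M y.
    apply: eq_bigr => y /BP[N [z [r h1 h2 h3]]].
    have [_ _ <-] := reach_admissible adM r.
    by rewrite (slack_in_saturated adM maxM r h1 h2 h3).
  rewrite sum_indeg -(cardsID [set p : V * V | p.2 \in B] [set p in M | p.1 \in A]).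
  apply: leq_add; apply: subset_leq_card; apply/subsetP=> -[z y]; rewrite !inE /=.
    case/andP=> zyM yB; rewrite yB zyM andbT /=; apply/negPn/negP => zA.
    have /BP[N [z' [r h1 h2 h3]]] := yB.
    case/negP: (zA); apply: (outA _ _ _ _ r h1 h2 h3).
    by rewrite (inv _ _ _ r) // (negbTE zA).
  case/and3P=> zyR zA yB; rewrite yB zA andbT /=.
  have /AP[N r h] := zA.
  have : (z, y) \in N.
    by apply: contraR yB => nN; apply/BP; exists N, z.
  by rewrite (inv _ _ _ r) // (negbTE yB) andbF.
exists M => // v; split=> //; apply/eqP; rewrite eqn_leq iM leqNgt; apply/negP => iv.
(* Out-degrees and in-degrees have the same sum |M|, so full out-degrees force full in-degrees. *)
have : \sum_y indeg M y < \sum_y g y.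
  by rewrite (bigD1 v) //= [X in _ < X](bigD1 v) //= -addSn leq_add //; apply: leq_sum.
by rewrite sum_indegT -(eq_bigr _ (fun x _ => full x)) sum_outdegT ltnn.
Qed.

(* This is [c - k <= (c - k) ^ 2] over the integers. *)
Lemma weight_bound c L k : L <= c -> k < c + L ->
  (1 + k) * (c + L - k) + (c - L) * k <= c ^ 2 + L.
Proof.
move=> /subnK <-; set r := c - L; rewrite addnK => hk.
have [j E] : exists j, j + k = r + L + L by exists (r + L + L - k); rewrite subnK // ltnW.
rewrite -E addnK expnS expn1.
have [h|h] := leqP k (r + L).
  have [s Es] : exists s, s + k = r + L by exists (r + L - k); rewrite subnK.
  have Ej : j = s + L by lia.
  rewrite -Es Ej; have : s <= s * s by case: s {Es Ej} => // s; rewrite leq_pmulr.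
  have : r * k + L * k = s * k + k * k by rewrite -mulnDl -Es mulnDl.
  by rewrite !mulnDl !mulnDr; lia.
have [s Es] : exists s, k = r + L + s by exists (k - (r + L)); rewrite subnKC // ltnW.
have Ej : L = s + j by lia.
rewrite Es Ej !(mulnDl, mulnDr); have : s <= s * s by case: s {Es Ej} => // s;
  rewrite leq_pmulr.
by nia.
Qed.

(** * The Ore-Hall condition from toughness *)

Section HallCondition.
Variable V : finType.
Implicit Types (x y z u v w : V) (A B C D I S : {set V}) (e f : {set V}) (E F X Y : {set
  {set V}}).

Definition nbrs F v := [set w | [set v; w] \in F].

Lemma card_nbrs F v : simple F -> #|nbrs F v| = deg F v.
Proof.
move=> sF; rewrite -(card_in_imset (f := fun w => [set v; w])).
  congr #|pred_of_set _|; apply/setP=> e; rewrite inE; apply/imsetP/andP => [[w]|[eF ve]].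
    by rewrite inE => vw ->; rewrite vw set21.
  by have [w wv De] := simple_endsx sF eF ve; exists w; rewrite // inE -De.
move=> w z; rewrite !inE => /(simple_neq sF) vw /(simple_neq sF) vz; exact: set2_inj.
Qed.

Variables (t c L : nat) (G X : {set {set V}}) (g : V -> nat).
Hypotheses (sG : simple G) (tG : nat_tough t G) (ncG : noncomplete G) (sXG : X \subset G).
Hypotheses (degX : forall v, deg X v <= L) (g_le : forall v, g v <= c) (g_ge : forall v,
  c - L <= g v).
Hypothesis large_t : c ^ 2 + L <= (c - L) * t.

Lemma L_le : L <= c.
Proof. by rewrite leqNgt; apply/negP => h; move: large_t;
  rewrite (eqP (ltnW h : c - L == 0)); lia. Qed.

Let d D x := #|nbrs G x :\: D|.
(** A bound for the part of [g x] not covered by the neighbours of [x] outside [D] in [G :\: X]: at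
    least [d D x - L] of them remain, and [g x] is at most [c]. *)
Let wt D x := c + L - d D x.

(** Repeatedly choose [x] with least [d D x] and discard its neighbours in [C]. Their weights are no
    larger than that of [x], and at most [1 + d D x] vertices disappear because [C] avoids [D]. *)
Lemma greedy_independent D C : [disjoint C & D] -> exists I, [/\ I \subset C,
  forall x y, x \in I -> y \in I -> [set x;
    y] \notin G, forall x, x \in I -> d D x < c + L &
  \sum_(x in C) wt D x <= \sum_(x in I) (1 + d D x) * wt D x].
Proof.
have [n] := ubnP #|C|; elim: n C => // n IHn C; rewrite ltnS => Cn dCD.
have [/existsP[z0 /andP[z0C z0d]]|/existsPn small] := boolP [exists x,
  (x \in C) && (d D x < c + L)]; last first.
  exists set0; split=> [|x y|x|]; rewrite ?sub0set ?inE // big_set0 big1 // => x xC.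
  by apply/eqP; rewrite subn_eq0 leqNgt; apply/negP => xd; case/negP: (small x); apply/andP.
case: (arg_minnP (d D) z0C) => x xC0 minx; have xC : x \in C := xC0.
have xd : d D x < c + L by apply: leq_ltn_trans (minx _ z0C) z0d.
pose C' := C :\: (x |: nbrs G x).
have sC' : C' \subset C by apply: subsetDl.
have xC' : x \notin C' by rewrite !inE eqxx.
have [||I [sI indI dI sumI]] := IHn C'.
- apply: leq_trans Cn; rewrite (cardsD1 x C) xC add1n ltnS; apply: subset_leq_card.
  by apply/subsetP=> z zC'; rewrite !inE (subsetP sC' _ zC') andbT;
    apply: contraNneq xC' => <-.
- exact: disjointWl sC' dCD.
have xI : x \notin I by apply: contra xC' => /(subsetP sI).
have nxI y : y \in I -> [set x; y] \notin G.
  by move/(subsetP sI); rewrite !inE negb_or => /andP[/andP[_ ->]].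
exists (x |: I); split.
- by rewrite subUset sub1set xC (subset_trans sI).
- move=> y z; rewrite !in_setU1 => /orP[/eqP->|yI] /orP[/eqP->|zI].
  + by apply/negP => /(simple_neq sG); rewrite eqxx.
  + exact: nxI.
  + by rewrite setUC; apply: nxI.
  + exact: indI.
- by move=> y; rewrite in_setU1 => /orP[/eqP->|/dI].
rewrite big_setU1 //= (bigID [in C']) /= addnC; apply: leq_add; last first.
  by rewrite (eq_bigl [in C']) // => z; rewrite /= andb_idl // => /(subsetP sC').
rewrite (eq_bigl [in C :&: (x |: nbrs G x)]); last first.
  by move=> z; rewrite !inE negb_and !negbK; case: (z \in C); rewrite //= ?andbF ?orbF.
apply: (@leq_trans (\sum_(z in C :&: (x |: nbrs G x)) wt D x)).
  by apply: leq_sum => z; rewrite inE => /andP[zC _]; apply: leq_sub2l; apply: minx.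
rewrite sum_nat_const leq_mul2r; apply/orP; right.
have sub : C :&: (x |: nbrs G x) \subset x |: (nbrs G x :\: D).
  apply/subsetP=> z; rewrite inE => /andP[zC]; rewrite !in_setU1 => /orP[->//|zN].
  by rewrite in_setD zN (disjointFr dCD zC) orbT.
apply: leq_trans (subset_leq_card sub) _; rewrite cardsU1 leq_add2r; exact: leq_b1.
Qed.

(** Deleting [D] and the neighbours of [I] isolates [I], so t|I| is at most |D| plus the sum of
    [d D] over [I]. Multiplying by c - L and using [weight_bound] at each vertex cancels the sums of
    [d D] and leaves a weight of at most (c - L)|D|. *)
Lemma hall_disjoint D C : [disjoint C & D] ->
  \sum_(x in C) g x <= \sum_(y in D) g y + \sum_(x in C) #|nbrs (G :\: X) x :\: D|.
Proof.
move=> dCD; have [I [sIC indI dI sumI]] := greedy_independent dCD.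
have sX : simple X by apply: simpleS sG.
have dle x : d D x <= #|nbrs (G :\: X) x :\: D| + L.
  apply: leq_trans (leq_add (leqnn _) (degX x)); rewrite -card_nbrs // /d.
  apply: leq_trans (leq_card_setU _ _); apply: subset_leq_card; apply/subsetP=> z.
  by rewrite !inE => /andP[-> ->]; case: (_ \in X).
have wtge : \sum_(x in C) g x <= \sum_(x in C) wt D x + \sum_(x in C) #|nbrs (G :\: X) x
  :\: D|.
  by rewrite -big_split; apply: leq_sum => x _; have := g_le x; have := dle x;
    rewrite /= /wt; move: (d D x) => k; clear; card_lia.
apply: leq_trans wtge _; rewrite leq_add2r.
apply: (@leq_trans ((c - L) * #|D|)); last first.
  by rewrite mulnC -sum_nat_const; apply: leq_sum => x _; apply: g_ge.
have [I0|[x0 x0I]] := set_0Vmem I.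
  by apply: leq_trans sumI _; rewrite I0 big_set0.
have ID x : x \in I -> x \notin D by move/(subsetP sIC) => xC; rewrite (disjointFr dCD xC).
pose S := D :|: \bigcup_(x in I) (nbrs G x :\: D).
have cS : #|S| <= #|D| + \sum_(x in I) d D x.
  by apply: leq_trans (leq_card_setU _ _) _; rewrite leq_add2l; apply: card_bigcup.
have IS x : x \in I -> x \notin S.
  move=> xI; rewrite in_setU negb_or ID //=; apply/bigcupP => -[y yI].
  by rewrite !inE => /andP[_]; apply/negP; apply: indI.
have iso x y : x \in I -> [set x; y] \in G -> y \in S.
  move=> xI xyG; rewrite in_setU; case yD: (y \in D) => //=.
  by apply/bigcupP; exists x => //; rewrite !inE yD.
have sep x z z' : x \in I -> z \notin S -> z' \notin S -> [set z;
  z'] \in G -> (z == x) = (z' == x).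
  move=> xI zS zS' zz; case: (eqVneq z x) => [zx|zx]; case: (eqVneq z' x) => [zx'|zx'] //.
    by move: zS'; rewrite (iso x) // -zx.
  by move: zS; rewrite (iso x) // -zx' setUC.
(* Toughness is silent for |I| = 1. Then [S] separates the vertex from another one, or [S] misses
   only this vertex and |V| >= 2t + 2 suffices. *)
have tI : t * #|I| <= #|S|.
  have [||I1|//] := tG (S := S) (I := I).
  - by apply/subsetP=> x /IS; rewrite in_setC.
  - move=> x y xI yI cxy; apply/esym/eqP.
    rewrite -(@conn_invariant _ _ bool (fun z => z == x) _ _ _ cxy) ?eqxx // => z z'.
    by rewrite in_inside set2_subset !in_setC => /and3P[zz zS zS']; apply: sep.
  have -> : #|I| = 1 by apply/eqP; rewrite eqn_leq I1; apply/card_gt0P; exists x0.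
  rewrite muln1; have [/existsP[y /andP[yS yx]]|/existsPn all] := boolP [exists y,
    (y \notin S) && (y != x0)].
    apply: (@leq_trans (2 * t)); first by rewrite leq_pmull.
    apply: (tough_sep tG (IS _ x0I) yS (c := pred1 x0)); rewrite /= ?eqxx //.
    by move=> z z' zS zS' zz; apply: sep.
  have : #|~: S| <= 1.
    rewrite -(cards1 x0); apply: subset_leq_card; apply/subsetP=> z;
      rewrite !inE -in_setU => zS.
    by move: (all z); rewrite zS /= negbK.
  have := cardsC S; have := card_noncomplete tG ncG; clear; card_lia.
have pointwise x : x \in I -> (1 + d D x) * wt D x + (c - L) * d D x <= (c - L) * t.
  move=> /dI; rewrite /wt; move: (d D x) => k hk;
    exact: leq_trans (weight_bound L_le hk) large_t.
have : \sum_(x in I) ((1 + d D x) * wt D x + (c - L) * d D x) <= \sum_(x in I) (c - L) * t.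
  exact: leq_sum.
rewrite big_split /= -big_distrr /= sum_nat_const => h1.
have h2 : #|I| * ((c - L) * t) <= (c - L) * (#|D| + \sum_(x in I) d D x).
  by rewrite mulnCA leq_mul2l mulnC (leq_trans tI cS) orbT.
rewrite mulnDr in h2; have h3 := leq_trans h1 h2.
by apply: leq_trans sumI _; move: h3; rewrite leq_add2r.
Qed.


Definition arcs_of F := [set p : V * V | [set p.1; p.2] \in F].

Lemma sum_nbrs F A B : \sum_(x in A) #|nbrs F x :\: B| = #|[set p in arcs_of F | (p.1 \in
  A) && (p.2 \notin B)]|.
Proof.
under eq_bigr do rewrite -sum1_card; rewrite pair_big_dep /= -sum1_card;
  apply: eq_bigl => -[x y].
by rewrite !inE /= [in RHS]andbCA [in RHS](andbC (_ \in F)).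
Qed.

Lemma half_factor : exists2 M : {set V * V}, M \subset arcs_of (G :\: X) &
  forall v, outdeg M v = g v /\ indeg M v = g v.
Proof.
apply: ore => A B.
rewrite (big_setID B) /= [\sum_(y in B) _](big_setID A) /= setIC -addnA leq_add2l.
have dAB : [disjoint A :\: B & B :\: A].
  by rewrite disjoints_subset; apply/subsetP=> z; rewrite !inE => /andP[/negbTE ->];
    rewrite andbF.
apply: leq_trans (hall_disjoint dAB) _; rewrite leq_add2l sum_nbrs.
(* After the demand on [A :&: B] is cancelled, arcs from [A :\: B] into [A :&: B] are still counted
   on the left. Reversed, they lead from [A] out of [B]; they start in [B], so they differ from the
   arcs kept. *)
pose h (p : V * V) := if p.2 \in B then (p.2, p.1) else p.
rewrite -(card_in_imset (f := h)).
  apply/subset_leq_card/subsetP=> q /imsetP[[x y] + ->]; rewrite inE /= => /and3P[xy xA yB].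
  move: xA yB; rewrite /h !in_setD /= => /andP[xB xA]; case yB: (y \in B) => /=.
    by rewrite andbT negbK => yA; rewrite inE /= yA xB !andbT; move: xy;
      rewrite !inE /= setUC.
  by move=> _; rewrite inE /= xA yB xy.
move=> [x y] [z w]; rewrite !inE /= -!andbA => /and5P[_ _ xB _ _] /and5P[_ _ zB _ _];
  rewrite /h /=.
case yB: (y \in B); case wB: (w \in B) => -[E1 E2].
- by rewrite E1 E2.
- by move: zB; rewrite -E1 yB.
- by move: xB; rewrite E1 wB.
- by rewrite E1 E2.
Qed.

End HallCondition.

(** * Eulerian trails *)

Section Trails.
Variable V : finType.
Implicit Types (x y z u v w p q : V) (U W : {set V}) (e f : {set V}) (H F : {set {set
  V}}) (s : seq V).

Fixpoint tedges x s := if s is y :: s' then [set x; y] :: tedges y s' else [::].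

Fixpoint alt (b : bool) x s :=
  if s is y :: s' then (if b then [set x;
    y] :: alt false y s' else alt true y s') else [::].

Lemma size_tedges x s : size (tedges x s) = size s.
Proof. by elim: s x => //= y s IHs x; rewrite IHs. Qed.

Lemma tedges_cat x s1 s2 : tedges x (s1 ++ s2) = tedges x s1 ++ tedges (last x s1) s2.
Proof. by elim: s1 x => //= y s IHs x; rewrite IHs. Qed.

Lemma alt_perm x s : perm_eq (alt true x s ++ alt false x s) (tedges x s).
Proof.
elim: s x => //= y s IHs x; rewrite perm_cons; apply: perm_trans (IHs y).
by rewrite perm_catC.
Qed.

(** Each inner visit to a vertex uses one edge of either class. Only the first and the last edge are
    unmatched, and parity of the length decides the class of the last. *)
Lemma alt_count x s v : (forall e, e \in tedges x s -> #|e| = 2) ->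
  count [pred e : {set V} | v \in e] (alt true x s) + (~~ odd (size s) && (v == last x s)) =
  count [pred e : {set V} | v \in e] (alt false x s) + (v == x) + (odd (size s) && (v ==
    last x s)).
Proof.
elim: s x => [|y s IHs] x /= h; first by rewrite addn0.
have {IHs} IH := IHs y (fun e he => h e (mem_behead he (s := _ :: _))).
have xy : x != y by have := h _ (mem_head _ _); rewrite cards2; case: (x != y).
have -> : (v \in [set x; y]) = (v == x) + (v == y) :> nat.
  by rewrite !inE; case: (eqVneq v x) => //= ->; rewrite (negbTE xy).
by move: IH; rewrite negbK; case: (odd (size s)) => /=; clear; lia.
Qed.

Lemma tedges_mem x s y z : [set y; z] \in tedges x s -> (y \in x :: s) && (z \in x :: s).
Proof.
elim: s x => //= w s IHs x;
  rewrite in_cons => /orP[/eqP/set2_eq[[-> ->]|[-> ->]]|/IHs/andP[h1 h2]].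
- by rewrite !inE !eqxx ?orbT.
- by rewrite !inE !eqxx ?orbT.
by rewrite in_cons h1 in_cons h2 !orbT.
Qed.

Definition trail H x s := uniq (tedges x s) && all [in H] (tedges x s).

Lemma deg_seq (l : seq {set V}) v : uniq l ->
  deg [set e in l] v = count [pred e : {set V} | v \in e] l.
Proof.
move=> ul; have -> : count [pred e : {set V} | v \in e] l = \sum_(e <- l) (v \in e).
  by rewrite -sum1_count big_mkcond; apply: eq_bigr => e _ /=; case: (v \in e).
by rewrite degE big_uniq //=; apply: eq_bigl => e; rewrite inE.
Qed.

Lemma deg0 v : deg (set0 : {set {set V}}) v = 0.
Proof. by rewrite degE big_set0. Qed.

Section Even.
Variable H : {set {set V}}.
Hypotheses (sH : simple H) (evenH : forall v, ~~ odd (deg H v)).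

Definition stuck x s := [forall y, ([set last x s; y] \in H) ==> ([set last x s;
  y] \in tedges x s)].

Lemma trail_size x s : trail H x s -> size s <= #|H|.
Proof.
case/andP=> u /allP sub; rewrite -(size_tedges x) cardE; apply: uniq_leq_size => // e /sub.
by rewrite mem_enum.
Qed.

Lemma trail_rcons x s y : trail H x s -> [set last x s; y] \in H -> [set last x s;
  y] \notin tedges x s ->
  trail H x (rcons s y).
Proof.
case/andP=> u a eH ne; rewrite /trail -cats1 tedges_cat /= cats1 rcons_uniq ne u
  all_rcons /=.
by rewrite a andbT.
Qed.

Lemma trail_stuck x s : trail H x s -> exists s', trail H x s' /\ stuck x s'.
Proof.
have [n] := ubnP (#|H| - size s); elim: n s => // n IHn s; rewrite ltnS => hn ts.
have [st|/forallPn[y]] := boolP (stuck x s); first by exists s.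
rewrite negb_imply => /andP[eH ne]; have ts' := trail_rcons ts eH ne.
apply: (IHn _ _ ts'); have := trail_size ts'; rewrite size_rcons; lia.
Qed.

Lemma trail_count x s v :
  count [pred e : {set V} | v \in e] (tedges x s) =
  count [pred e : {set V} | v \in e] (alt true x s) + count [pred e : {set V} | v \in e]
    (alt false x s).
Proof. by rewrite -count_cat; apply/permP; rewrite perm_sym alt_perm. Qed.

Lemma trail_set x s : trail H x s -> [set e in tedges x s] \subset H.
Proof. by case/andP=> _ /allP sub; apply/subsetP=> e; rewrite inE => /sub. Qed.

Lemma trail_alt x s v : trail H x s ->
  count [pred e : {set V} | v \in e] (alt true x s) + (~~ odd (size s) && (v == last x s)) =
  count [pred e : {set V} | v \in e] (alt false x s) + (v == x) + (odd (size s) && (v ==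
    last x s)).
Proof. by case/andP=> _ /allP sub; apply: alt_count => e /sub /sH. Qed.

Lemma stuck_closed x s : trail H x s -> stuck x s -> last x s = x.
Proof.
move=> ts /forallP st; apply/eqP; apply/negPn/negP => ne; set l := last x s in st ne.
have := evenH l; have -> : deg H l = count [pred e : {set V} | l \in e] (tedges x s).
  rewrite -deg_seq; last by case/andP: ts.
  apply: deg_eq => e le; rewrite inE; apply/idP/idP => [eH|];
    last by have /andP[_ /allP sub] := ts; move/sub.
  by have [y _ De] := simple_endsx sH eH le; have := st y; rewrite -De eH.
rewrite trail_count => /negP; apply; have := trail_alt l ts.
by rewrite -/l eqxx (negbTE ne) !andbT addn0; case: (odd (size s)) => /=; clear; lia.
Qed.

Lemma uniq_alt b x s : trail H x s -> uniq (alt b x s).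
Proof.
case/andP=> u _; have : uniq (alt true x s ++ alt false x s) by rewrite (perm_uniq
  (alt_perm x s)).
by rewrite cat_uniq => /and3P[]; case: b.
Qed.

Lemma alt_sub b x s : {subset alt b x s <= tedges x s}.
Proof.
by move=> e eb; rewrite -(perm_mem (alt_perm x s)) mem_cat; case: b eb => ->; rewrite ?orbT.
Qed.

Lemma trail_rot x s p : trail H x s -> last x s = x -> p \in x :: s ->
  exists s', [/\ trail H p s', last p s' = p, size s' = size s & tedges p s' =i tedges x s].
Proof.
move=> /andP[u a] ls ps; move: u a ls; case/splitPl: ps => s1 s2 <-{p}.
rewrite tedges_cat last_cat => u a ls.
have P : perm_eq (tedges (last x s1) (s2 ++ s1)) (tedges x s1 ++ tedges (last x s1) s2).
  by rewrite tedges_cat ls perm_catC.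
exists (s2 ++ s1); split.
- by rewrite /trail (perm_uniq P) (perm_all _ P) u.
- by rewrite last_cat ls.
- by rewrite !size_cat addnC.
- by move=> e; rewrite (perm_mem P).
Qed.

(** A closed trail missing an edge at one of its vertices is rotated to that vertex and prolonged;
    otherwise its vertices are closed under adjacency, hence all of [V]. *)
Lemma euler x s : spans H -> trail H x s ->
  exists y s', [/\ trail H y s', last y s' = y & forall e, e \in H -> e \in tedges y s'].
Proof.
move=> cH; have [n] := ubnP (#|H| - size s); elim: n x s => // n IHn x s;
  rewrite ltnS => hn ts.
have [st|/forallPn[y]] := boolP (stuck x s); last first.
  rewrite negb_imply => /andP[eH ne]; have ts' := trail_rcons ts eH ne.
  by apply: (IHn _ _ _ ts'); have := trail_size ts'; rewrite size_rcons; lia.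
have ls := stuck_closed ts st.
have [/existsP[p /existsP[q /and3P[ps pqH npq]]]|/existsPn none] :=
    boolP [exists p, exists q, [&& p \in x :: s, [set p; q] \in H & [set p;
      q] \notin tedges x s]].
  have [s' [ts' ls' ss' es']] := trail_rot ts ls ps.
  have ts2 : trail H p (rcons s' q) by apply: trail_rcons; rewrite // ls' // es'.
  by apply: (IHn _ _ _ ts2); have := trail_size ts2; rewrite size_rcons; lia.
have all_in p q : p \in x :: s -> [set p; q] \in H -> [set p; q] \in tedges x s.
  move=> ps pqH; have /existsPn/(_ q) := none p; by rewrite ps pqH /= negbK.
exists x, s; split=> // e eH; have [p [q [_ De]]] := simple_ends sH eH.
rewrite De in eH *; apply: (all_in _ _ _ eH).
have : ((x \in x :: s) ==> (p \in x :: s)); last by rewrite mem_head.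
apply: (conn_sub (r := fun u v => (u \in x :: s) ==> (v \in x :: s))) (cH x p).
- by move=> u; apply/implyP.
- by move=> u v w /implyP h1 /implyP h2; apply/implyP => /h1/h2.
by move=> u v uvH; apply/implyP => us; have /tedges_mem/andP[] := all_in _ _ us uvH.
Qed.

Lemma halve_connected : spans H -> ~~ odd #|H| ->
  exists2 H' : {set {set V}}, H' \subset H & forall v, 2 * deg H' v = deg H v.
Proof.
move=> cH eH; have [H0|[e eHin]] := set_0Vmem H.
  by exists set0; rewrite ?sub0set // => v; rewrite H0 deg0.
have [x [y [_ De]]] := simple_ends sH eHin.
have [z [s [ts ls cov]]] := euler cH (isT : trail H x [::]).
have EH : [set e in tedges z s] = H.
  by apply/eqP; rewrite eqEsubset trail_set //; apply/subsetP=> f /cov; rewrite inE.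
have uts : uniq (tedges z s) by case/andP: ts.
have sz : size s = #|H| by rewrite -EH -(size_tedges z) cardsE; apply/esym/card_uniqP.
exists [set e in alt true z s].
  by apply/subsetP=> f; rewrite inE => /alt_sub; rewrite -EH inE.
move=> v; rewrite -EH !deg_seq ?uniq_alt ?(uniq_alt _ ts) // trail_count.
by have := trail_alt v ts; rewrite sz (negbTE eH) ls /= addn0; clear; lia.
Qed.

End Even.

Lemma degD F H v : F \subset H -> deg H v = deg F v + deg (H :\: F) v.
Proof.
move=> sFH; rewrite -degU; last by rewrite disjoints_subset; apply/subsetP=> e;
  rewrite !inE => ->.
congr deg; apply/setP=> e; rewrite !inE; have := subsetP sFH e.
by case: (e \in F) => //= ->.
Qed.

(** Closed trails are peeled off. An odd one errs only at its base [x]; being stuck there, it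
    exhausts the edges at [x], so no later trail errs at [x] again. *)
Lemma halve_even H : simple H -> (forall v, ~~ odd (deg H v)) ->
  exists2 H' : {set {set V}}, H' \subset H & forall v,
    2 * deg H' v = deg H v \/ 2 * deg H' v + 2 = deg H v.
Proof.
have [n] := ubnP #|H|; elim: n H => // n IHn H; rewrite ltnS => hn sH eH.
have [->|[e eHin]] := set_0Vmem H.
  by exists set0 => // v; left; rewrite deg0.
have [x [y [_ De]]] := simple_ends sH eHin.
have [s [ts st]] := trail_stuck (isT : trail H x [::]).
have ls := stuck_closed sH eH ts st.
pose C := [set f in tedges x s]; have sCH : C \subset H by apply: trail_set.
have uts : uniq (tedges x s) by case/andP: ts.
have eC : e \in C by have /forallP/(_ y) := st; rewrite ls -De eHin inE.
have degC v : deg C v = count [pred e : {set V} | v \in e] (alt true x s) + count [pred e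
  : {set V} | v \in e] (alt false x s).
  by rewrite deg_seq // trail_count.
have alts v := trail_alt sH v ts.
have par v : ~~ odd (deg C v).
  by rewrite degC; have := alts v; rewrite ls; case: (odd (size s));
    case: (v == x) => /=; clear; lia.
have [||v|H'' sH'' dH''] := IHn (H :\: C).
- apply: leq_trans hn; rewrite [#|H|](cardsD1 e) eHin ltnS; apply: subset_leq_card.
  apply/subsetP=> f; rewrite in_setD => /andP[fC fH]; rewrite !inE fH andbT.
  by apply: contraNneq fC => ->.
- by apply: simpleS sH; apply: subsetDl.
- by have := eH v; rewrite (degD v sCH) oddD (negbTE (par v)).
have x0 : deg (H :\: C) x = 0.
  apply/eqP; rewrite cards_eq0; apply/eqP/setP=> f; rewrite !inE;
    apply/negP => /andP[/andP[nf fH] xf].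
  have [z _ Df] := simple_endsx sH fH xf; have /forallP/(_ z) := st.
  by rewrite ls -Df fH (negbTE nf).
(* Keeping the class without the first edge makes the error of an odd trail a deficit. *)
have sA : [set f in alt false x s] \subset C by apply/subsetP=> f; rewrite !inE => /alt_sub.
exists (H'' :|: [set f in alt false x s]).
  by rewrite subUset (subset_trans sH'' (subsetDl _ _)) (subset_trans sA).
move=> v; have dj : [disjoint H'' & [set f in alt false x s]].
  rewrite disjoints_subset; apply/subsetP=> f /(subsetP sH'');
    rewrite in_setD in_setC => /andP[fC _].
  by apply: contra fC => /(subsetP sA).
rewrite degU // [deg [set _ in _] _]deg_seq ?(uniq_alt _ ts) // (degD v sCH) degC.
have := alts v; have := dH'' v; rewrite ls.
have [->|vx] := eqVneq v x; first by rewrite x0; case: (odd (size s)) => /=; clear; lia.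
by rewrite !andbF !addn0; clear; lia.
Qed.

Definition symdiff F H := (F :\: H) :|: (H :\: F).

Lemma odd_symdiff F H v : odd (deg (symdiff F H) v) = odd (deg F v) (+) odd (deg H v).
Proof.
rewrite degU; last first.
  by rewrite disjoints_subset; apply/subsetP=> e; rewrite !inE => /andP[/negbTE-> ->].
have E (A B : {set {set V}}) : deg A v = deg (A :&: B) v + deg (A :\: B) v.
  rewrite (degD v (subsetIl A B)); congr (_ + deg _ v).
  by apply/setP=> e; rewrite !inE; case: (e \in A); rewrite ?andbF ?andbT.
rewrite [deg F v](E F H) [deg H v](E H F) setIC !oddD.
by case: (odd _); case: (odd _); case: (odd _).
Qed.

Lemma symdiff_sub F H (E : {set {set V}}) : F \subset E -> H \subset E ->
  symdiff F H \subset E.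
Proof. by move=> sF sH; rewrite subUset !(subset_trans (subsetDl _ _)). Qed.

Section Join.
Variable T : {set {set V}}.
Hypotheses (sT : simple T) (cT : spans T).

Lemma path_parity u w : exists2 P : {set {set V}}, P \subset T & forall v,
  odd (deg P v) = (v == u) (+) (v == w).
Proof.
have /connectP[s] := cT u w; elim: s u => [|y s IHs] u /=.
  by move=> _ ->; exists set0; rewrite ?sub0set // => v; rewrite deg0 addbb.
case/andP=> uy ps lw; have [P sP hP] := IHs y ps lw.
exists (symdiff P [set [set u; y]]); first by rewrite symdiff_sub // sub1set.
move=> v; rewrite odd_symdiff hP degE big_set1 !inE.
have := simple_neq sT uy; case: (eqVneq v u) => [->|_].
  by move/negbTE->; rewrite /=; case: (u == w).
by move=> _; rewrite /=; case: (v == y); case: (v == w).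
Qed.

(** Pairs of vertices of [Z] are joined by walks in [T], and these are added modulo 2. *)
Lemma join_parity (Z : {set V}) : ~~ odd #|Z| ->
  exists2 J : {set {set V}}, J \subset T & forall v, odd (deg J v) = (v \in Z).
Proof.
have [n] := ubnP #|Z|; elim: n Z => // n IHn Z; rewrite ltnS => hn eZ.
have [->|[u uZ]] := set_0Vmem Z.
  by exists set0; rewrite ?sub0set // => v; rewrite deg0 inE.
have cu : #|Z| = (#|Z :\ u|).+1 by rewrite (cardsD1 u) uZ.
have [w wZ] : exists w, w \in Z :\ u.
  by apply/set0Pn; apply: contraNneq eZ => E; rewrite cu E cards0.
have cw : #|Z :\ u| = (#|Z :\ u :\ w|).+1 by rewrite (cardsD1 w) wZ.
have [||J sJ hJ] := IHn (Z :\ u :\ w).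
- by rewrite cu cw in hn; apply: leq_trans hn; rewrite ltnS leqnSn.
- by rewrite cu cw /= negbK in eZ.
have [P sP hP] := path_parity u w.
exists (symdiff J P); first exact: symdiff_sub.
move=> v; rewrite odd_symdiff hJ hP; move: wZ; rewrite !inE => /andP[wu wZ].
case: (eqVneq v u) => [->|vu]; first by rewrite uZ andbF eq_sym (negbTE wu).
by case: (eqVneq v w) => [->|vw]; rewrite ?wZ //= addbF.
Qed.

End Join.

End Trails.

(** * Complete graphs *)

Section EdgesOf.
Variable V : finType.
Implicit Types (u v w : V) (r : rel V).

Definition edges_of r := [set e : {set V} | [exists u, exists w, (e == [set u;
  w]) && r u w]].

Lemma in_edges_of r u w : symmetric r -> ([set u; w] \in edges_of r) = r u w.
Proof.
move=> sr; rewrite inE; apply/existsP/idP =>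
  [[x /existsP[y /andP[/eqP/set2_eq[[-> ->]|[-> ->]]]]]|ruw] //.
  by rewrite sr.
by exists u; apply/existsP; exists w; rewrite eqxx.
Qed.

Lemma edges_ofP r e : e \in edges_of r -> exists u w, e = [set u; w] /\ r u w.
Proof. by rewrite inE => /existsP[u /existsP[w /andP[/eqP-> h]]]; exists u, w. Qed.

Lemma edges_of_simple r : irreflexive r -> simple (edges_of r).
Proof.
move=> ir e /edges_ofP[u [w [-> h]]]; rewrite cards2.
by case: eqP h => // ->; rewrite ir.
Qed.

Lemma deg_edges_of r v : symmetric r -> irreflexive r ->
  deg (edges_of r) v = #|[set w | r v w]|.
Proof.
move=> sr ir; rewrite -card_nbrs; last exact: edges_of_simple.
by apply: eq_card => w; rewrite !inE -(in_edges_of v w sr) inE.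
Qed.

End EdgesOf.

Section Circulant.
Variable n' : nat.
Local Notation n := n'.+1.
Local Open Scope ring_scope.
Implicit Types (x y : 'I_n) (D : {set 'I_n}).

Definition connection_set D := [/\ forall x, x \in D -> - x \in D & 0 \notin D].

Lemma val_opp x : x != 0 -> (- x : 'I_n) = (n - x)%N :> nat.
Proof.
move=> x0; have xn : (x : nat) <> 0%N by move=> E; case/eqP: x0; apply: val_inj.
by rewrite /= modn_small //; lia.
Qed.

(** The set consists of 1, ..., h and their negatives in Z/n. Its bound on the distance from 0 shows
    that the next pair is new, and later that n/2 is still free. *)
Lemma even_connection_set h : (2 * h < n)%N ->
  exists D, [/\ connection_set D, #|D| = (2 * h)%N,
  forall x, x \in D -> (x <= h)%N || (n - x <= h)%N & (0 < h)%N -> inZp 1 \in D].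
Proof.
elim: h => [|h IHh] hn.
  exists set0; split; rewrite ?cards0 //; first by split=> [x|]; rewrite inE.
  by move=> x; rewrite inE.
have [|D [[sD D0] cD bD oD]] := IHh; first by lia.
pose a : 'I_n := inZp h.+1.
have va : a = h.+1 :> nat by rewrite /= modn_small //; lia.
have a0 : a != 0 by apply/eqP => E; move: va; rewrite E.
have vb := val_opp a0; rewrite va in vb.
have aD : a \notin D by apply/negP => /bD; rewrite va; lia.
have bnD : - a \notin D by apply/negP => /bD; rewrite vb; lia.
have ab : a != - a by apply/eqP => E; move: vb; rewrite -E va; lia.
exists (a |: (- a |: D)); split.
- split=> [x|]; last by rewrite !inE eq_sym (negbTE a0) eq_sym oppr_eq0 (negbTE a0).
  rewrite !inE => /or3P[/eqP->|/eqP->|/sD->]; by rewrite ?opprK ?eqxx ?orbT.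
- by rewrite !cardsU1 bnD !inE negb_or ab aD cD; lia.
- move=> x; rewrite !inE => /or3P[/eqP->|/eqP->|/bD]; [rewrite va|rewrite vb|]; lia.
move=> _; have [h0|h0] := posnP h; last by rewrite !inE oD ?orbT.
by rewrite in_setU1 /a h0 eqxx.
Qed.

(** For odd [c] the parity hypothesis makes n even, and the involution n/2 is the last element. *)
Lemma connection_set_exists c : (1 < c)%N -> (c < n)%N -> ~~ odd (c * n) ->
  exists D, [/\ connection_set D, #|D| = c & inZp 1 \in D].
Proof.
move=> c1 cn ev; have cE := odd_double_half c; rewrite -mul2n in cE.
have [|D [[sD D0] cD bD oD]] := @even_connection_set c./2; first by lia.
have {}oD : inZp 1 \in D by apply: oD; lia.
case oc: (odd c) cE => cE; last by exists D; split=> //; rewrite cD; exact: cE.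
move: ev; rewrite oddM oc andTb => en.
have nE := odd_double_half n; rewrite (negbTE en) add0n -mul2n in nE.
have lt2 : (n./2 < n)%N by lia.
pose a : 'I_n := Ordinal lt2; have va : a = n./2 :> nat by [].
have a0 : a != 0 by apply/eqP => /(congr1 val) /=; lia.
have aa : - a = a by apply: val_inj; rewrite [LHS](val_opp a0) /=; lia.
have aD : a \notin D by apply/negP => /bD; rewrite va; lia.
exists (a |: D); split.
- split=> [x|]; last by rewrite !inE eq_sym (negbTE a0).
  by rewrite !inE => /orP[/eqP->|/sD->]; rewrite ?aa ?eqxx ?orbT.
- by rewrite cardsU1 aD cD; lia.
by rewrite inE oD orbT.
Qed.

End Circulant.

Lemma circulant (V : finType) c : 1 < c -> c < #|V| -> ~~ odd (c * #|V|) ->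
  exists F : {set {set V}}, [/\ simple F, spans F & forall v, deg F v = c].
Proof.
case E: #|V| => [|n'] // c1 cn ev;
  have [D [[sD D0] cD oD]] := connection_set_exists c1 cn ev.
pose p (v : V) : 'I_n'.+1 := cast_ord E (enum_rank v).
pose q (x : 'I_n'.+1) : V := enum_val (cast_ord (esym E) x).
have pK : cancel p q by move=> v; rewrite /p /q cast_ordK enum_rankK.
have qK : cancel q p by move=> x; rewrite /p /q enum_valK cast_ordKV.
pose r u w := (p u - p w)%R \in D.
have sr : symmetric r.
  by move=> u w; apply/idP/idP => /sD; rewrite opprB.
have ir : irreflexive r by move=> u; rewrite /r subrr (negbTE D0).
exists (edges_of r); split.
- exact: edges_of_simple.
- have step v k : conn (edges_of r) v (q (p v + inZp 1 *+ k)%R).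
    elim: k => [|k IHk]; first by rewrite mulr0n addr0 pK conn_refl.
    apply: conn_trans IHk (conn1 _); rewrite in_edges_of // sr /r !qK mulrSr addrA.
    by rewrite [X in (X - _)%R]addrC addrK.
  move=> u w; have := step u (p w - p u)%R; rewrite Zp_mulrn.
  have -> : inZp ((inZp 1 : 'I_n'.+1) * (p w - p u)%R) = (p w - p u)%R.
    rewrite [val (inZp 1)]/= modn_small; last by lia.
    by rewrite mul1n valZpK.
  by rewrite addrC subrK pK.
move=> v; rewrite deg_edges_of // -cD -(card_imset (mem D) (f := fun x => q (p v - x)%R)).
  apply: eq_card => w; rewrite inE; apply/idP/imsetP => [vw|[x xD ->]].
    by exists (p v - p w)%R; rewrite // opprB addrCA subrr addr0 pK.
  by rewrite /r qK opprB addrCA subrr addr0.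
by move=> x y /(can_inj qK)/addrI/oppr_inj.
Qed.

(** * Factors of tough graphs *)

Section Split.
Variable V : finType.
Implicit Types (u v w : V) (M : {set V * V}) (F N : {set {set V}}).

(** Arcs encode a {0, 1/2, 1}-weighting: weight 1 if both directions are present, and 1/2 for the
    edges of [single M]. *)
Definition both M := edges_of [rel u w | ((u, w) \in M) && ((w, u) \in M)].
Definition single M := edges_of [rel u w | ((u, w) \in M) (+) ((w, u) \in M)].

Variables (N : {set {set V}}) (M : {set V * V}).
Hypotheses (sN : simple N) (sMN : M \subset arcs_of N).

Let bothP : symmetric [rel u w | ((u, w) \in M) && ((w, u) \in M)].
Proof. by move=> u w; rewrite /= andbC. Qed.

Let singleP : symmetric [rel u w | ((u, w) \in M) (+) ((w, u) \in M)].
Proof. by move=> u w; rewrite /= addbC. Qed.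

Lemma arcs_irr u : (u, u) \notin M.
Proof. by apply/negP => /(subsetP sMN); rewrite inE => /(simple_neq sN); rewrite eqxx. Qed.

Lemma both_sub : both M \subset N.
Proof.
apply/subsetP=> e /edges_ofP[u [w [-> /andP[uw _]]]].
by have := subsetP sMN _ uw; rewrite inE.
Qed.

Lemma single_sub : single M \subset N.
Proof.
apply/subsetP=> e /edges_ofP[u [w [-> /=]]].
case uw: ((u, w) \in M) => /=; first by have := subsetP sMN _ uw; rewrite inE.
by move=> wu; have := subsetP sMN _ wu; rewrite inE setUC.
Qed.

Lemma both_single_disjoint : [disjoint both M & single M].
Proof.
rewrite disjoints_subset; apply/subsetP=> e /edges_ofP[u [w [-> /andP[uw wu]]]].
by rewrite inE in_edges_of //= uw wu.
Qed.

Lemma split_degree v : 2 * deg (both M) v + deg (single M) v = outdeg M v + indeg M v.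
Proof.
have irr u := negbTE (arcs_irr u).
rewrite !deg_edges_of //=; try by move=> u; rewrite /= irr.
pose A := [set w | (v, w) \in M]; pose B := [set w | (w, v) \in M].
have -> : outdeg M v = #|A|.
  rewrite /outdeg -(card_imset (mem A) (f := pair v)); last by move=> ? ? [].
  apply: eq_card => -[x y]; rewrite !inE /=; apply/andP/imsetP => [[xyM /eqP xv]|[w]].
    by exists y; rewrite ?inE -?xv.
  by rewrite inE => vw [-> ->].
have -> : indeg M v = #|B|.
  rewrite /indeg -(card_imset (mem B) (f := fun w => (w, v))); last by move=> ? ? [].
  apply: eq_card => -[x y]; rewrite !inE /=; apply/andP/imsetP => [[xyM /eqP yv]|[w]].
    by exists x; rewrite ?inE -?yv.
  by rewrite inE => vw [-> ->].
have -> : #|[set w | ((v, w) \in M) && ((w, v) \in M)]| = #|A :&: B|.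
  by apply: eq_card => w; rewrite !inE.
have -> : #|[set w | ((v, w) \in M) (+) ((w, v) \in M)]| = #|A :\: B| + #|B :\: A|.
  rewrite -cardsUI (_ : (A :\: B) :&: (B :\: A) = set0) ?cards0 ?addn0; last first.
    by apply/setP=> w; rewrite !inE; case: (_ \in M); case: (_ \in M).
  by apply: eq_card => w; rewrite !inE; case: (_ \in M); case: (_ \in M).
by rewrite -(cardsID B A) -(cardsID A B) [B :&: A]setIC; clear; card_lia.
Qed.

End Split.

(** The condition [large_t] for L = 3, the degree bound at m = 1; [64] serves c <= 6, and t >= 2c
    serves the rest. *)
Lemma near_bound c t : 64 <= t -> 2 * c <= t -> 4 < c -> c ^ 2 + 3 <= (c - 3) * t.
Proof.
move=> t64 t2c c5; have [h|h] := leqP c 6; first by rewrite expnS expn1; nia.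
by apply: (@leq_trans ((c - 3) * (2 * c))); [rewrite expnS expn1;
  nia|rewrite leq_mul2l t2c orbT].
Qed.

(** The same for L = 7, the degree bound at m = 3, with the change at c = 14. *)
Lemma exact_bound c t : 256 <= t -> 2 * c <= t -> 8 < c -> c ^ 2 + 7 <= (c - 7) * t.
Proof.
move=> t256 t2c c9; have [h|h] := leqP c 14; first by rewrite expnS expn1; nia.
by apply: (@leq_trans ((c - 7) * (2 * c))); [rewrite expnS expn1;
  nia|rewrite leq_mul2l t2c orbT].
Qed.

Section Factors.
Variables (V : finType) (t : nat) (G : {set {set V}}).
Hypotheses (sG : simple G) (tG : nat_tough t G) (ncG : noncomplete G).
Implicit Types (u v w : V) (F X : {set {set V}}).

Lemma disjoint_setD F F' X : F \subset X -> F' \subset G :\: X -> [disjoint F & F'].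
Proof.
move=> sFX sF'; apply: disjointWl sFX _; rewrite disjoint_sym; apply: disjointWl sF' _.
by rewrite disjoints_subset; apply/subsetP=> e; rewrite !inE => /andP[].
Qed.

Lemma disjointUl (A B C : {set {set V}}) : [disjoint A & C] -> [disjoint B & C] ->
  [disjoint A :|: B & C].
Proof. by rewrite !disjoints_subset subUset => -> ->. Qed.

Lemma spansW F F' : F \subset F' -> spans F -> spans F'.
Proof. by move=> sFF' hF u v; apply: connW (hF u v). Qed.

Lemma connected_near_factor c : 64 <= t -> 2 * c <= t -> 4 < c -> exists F : {set {set V}},
  [/\ F \subset G, spans F & forall v, deg F v = c \/ deg F v + 1 = c].
Proof.
move=> t64 t2c c5.
have [|X [bX dX]] := @bounded_base V 1 t G isT sG tG ncG; first by move: t64; clear; lia.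
have /and3P[sXG spX tX] := bX; have sX : simple X by apply: simpleS sG.
have [T [sTX _ cT]] := nash_williams sX spX tX.
have cX : spans X by apply: spansW (sTX ord0) (cT ord0).
pose g v := c - deg X v.
have large : c ^ 2 + 3 <= (c - 3) * t by apply: near_bound.
have [||M sM dM] := half_factor (g := g) sG tG ncG sXG dX _ _ large.
- by move=> v; apply: leq_subr.
- by move=> v; apply: leq_sub2l; apply: dX.
have sN : simple (G :\: X) by apply: simpleS sG; apply: subsetDl.
have dg v : 2 * deg (both M) v + deg (single M) v = 2 * g v.
  by rewrite (split_degree sN sM); have [-> ->] := dM v; rewrite mul2n addnn.
have sS : simple (single M) by apply: simpleS sN; apply: single_sub sM.
have [|H sH dH] := halve_even sS; first by move=> v; have := dg v; clear; lia.
have sHN := subset_trans sH (single_sub sM).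
exists (X :|: (both M :|: H)); split.
- rewrite subUset sXG subUset (subset_trans (both_sub sM) (subsetDl _ _)).
  exact: subset_trans sHN (subsetDl _ _).
- by apply: spansW cX; apply: subsetUl.
move=> v; rewrite degU; last first.
  by apply: disjoint_setD (subxx X) _; rewrite subUset (both_sub sM) sHN.
rewrite degU; last by apply: disjointWr sH _; exact: both_single_disjoint.
have := dH v; have := dg v; have := dX v; rewrite /g; move: c5; clear; lia.
Qed.

Lemma connected_exact_factor c : 256 <= t -> 2 * c <= t -> 8 < c -> ~~ odd (c * #|V|) ->
  exists F : {set {set V}}, [/\ F \subset G, spans F & forall v, deg F v = c].
Proof.
move=> t256 t2c c9 ev.
have [|X [bX dX]] := @bounded_base V 3 t G isT sG tG ncG; first by move: t256; clear; lia.
have /and3P[sXG spX tX] := bX; have sX : simple X by apply: simpleS sG.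
have [T [sTX dT cT]] := nash_williams sX spX tX.
pose T0 := T (inord 0); pose T1 := T (inord 1); pose T2 := T (inord 2).
have neq i j : i < 3 -> j < 3 -> i != j -> (inord i : 'I_3) != inord j.
  by move=> i3 j3; rewrite -(inj_eq val_inj) /= !inordK.
have d01 : [disjoint T0 & T1] by apply/dT/neq.
have d02 : [disjoint T0 & T2] by apply/dT/neq.
have d12 : [disjoint T1 & T2] by apply/dT/neq.
have sT i : simple (T i) by apply: simpleS (sTX i) sX.
pose Z := [set v | odd (deg T1 v)].
have eZ : ~~ odd #|Z|.
  have -> : #|Z| = \sum_v (odd (deg T1 v) : nat).
    by rewrite -sum1_card big_mkcond; apply: eq_bigr => v _; rewrite inE; case: (odd _).
  have /(congr1 odd) := sum_degT (sT (inord 1)); rewrite oddM /= => E.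
  rewrite (big_morph odd oddD (erefl (odd 0))) in E;
    rewrite (big_morph odd oddD (erefl (odd 0))).
  by under eq_bigr do rewrite oddb; rewrite E.
have [J sJ hJ] := join_parity (sT (inord 2)) (cT (inord 2)) eZ.
pose K := T1 :|: J.
have dK v : deg K v = deg T1 v + deg J v.
  by apply: degU; apply: disjointWr sJ d12.
have eK v : ~~ odd (deg K v) by rewrite dK oddD hJ inE addbb.
have sKX : K \subset X by rewrite subUset sTX (subset_trans sJ).
have d0K : [disjoint T0 & K].
  by rewrite disjoint_sym; apply: disjointUl; rewrite disjoint_sym //;
    apply: disjointWr sJ d02.
have d7 v : deg T0 v + deg K v <= 7.
  rewrite -degU //; apply: leq_trans (dX v); apply: deg_sub; by rewrite subUset sTX.
(* [K] is going to be halved, so only half of its degree is subtracted. *)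
pose g v := c - (deg T0 v + (deg K v)./2).
have large : c ^ 2 + 7 <= (c - 7) * t by apply: exact_bound.
have [||M sM dM] := half_factor (g := g) sG tG ncG sXG dX _ _ large.
- by move=> v; apply: leq_subr.
- by move=> v; apply: leq_sub2l; have := d7 v; clear; lia.
have sN : simple (G :\: X) by apply: simpleS sG; apply: subsetDl.
have dg v : 2 * deg (both M) v + deg (single M) v = 2 * g v.
  by rewrite (split_degree sN sM); have [-> ->] := dM v; rewrite mul2n addnn.
pose H := K :|: single M.
have dH v : deg H v = deg K v + deg (single M) v.
  by apply: degU; apply: disjoint_setD sKX (single_sub sM).
have sH : simple H by apply: simpleS sG;
  rewrite subUset (subset_trans sKX sXG) (subset_trans (single_sub sM)) ?subsetDl.
have eH v : ~~ odd (deg H v) by have := dg v; have := eK v; rewrite dH; clear; lia.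
have cH : spans H by apply: spansW (cT (inord 1)); rewrite -/T1 /H /K -setUA subsetUl.
have total v : 2 * deg T0 v + 2 * deg (both M) v + deg H v = 2 * c.
  by rewrite dH; have := dg v; have := eK v; have := d7 v; rewrite /g; move: c9; clear; lia.
have sB : simple (both M) by apply: simpleS sN; apply: both_sub sM.
(* Summing [total] gives |H| = c|V| - 2|T0| - 2|both M|, which is even because c|V| is. *)
have cardH : ~~ odd #|H|.
  have : \sum_v (2 * deg T0 v + 2 * deg (both M) v + deg H v) = \sum_(v : V) (c + c).
    by apply: eq_bigr => v _; rewrite addnn -mul2n; apply: total.
  have sT0 : simple T0 := sT _.
  rewrite !big_split /= !(sum_degT sT0, sum_degT sB,
    sum_degT sH) !sum_nat_const !muln0 !addn0.
  rewrite [_ * c]mulnC.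
  move: (c * #|V|) ev => k ev.
  move: #|T0| #|both M| #|H| => x y z; clear -ev; lia.
have [H' sH' dH'] := halve_connected sH eH cH cardH.
have dbH : [disjoint both M & H'].
  apply: disjointWr sH' _; rewrite disjoint_sym; apply: disjointUl.
    by apply: disjoint_setD sKX (both_sub sM).
  by rewrite disjoint_sym; apply: both_single_disjoint.
have d0 : [disjoint T0 & both M :|: H'].
  rewrite disjoint_sym; apply: disjointUl.
    by rewrite disjoint_sym; apply: disjoint_setD (sTX _) (both_sub sM).
  apply: disjointWl sH' _; apply: disjointUl; first by rewrite disjoint_sym.
  by rewrite disjoint_sym; apply: disjoint_setD (sTX _) (single_sub sM).
exists (T0 :|: (both M :|: H')); split.
- rewrite !subUset (subset_trans (sTX _) sXG) (subset_trans (both_sub sM) (subsetDl _ _)).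
  apply: subset_trans sH' _; rewrite subUset (subset_trans sKX sXG).
  exact: subset_trans (single_sub sM) (subsetDl _ _).
- by apply: spansW (cT (inord 0)); apply: subsetUl.
by move=> v; rewrite !degU //; have := dH' v; have := total v; clear; lia.
Qed.

End Factors.

(** * Passage between a multigraph and its underlying simple graph *)

Section Transfer.
Variable G : multigraph.
Local Notation V := (vertex G).

Definition underlying : {set {set V}} := [set ends e | e : edge G].

Lemma underlying_simple : simple underlying.
Proof. by move=> _ /imsetP[e _ ->]; apply: card_ends. Qed.

Lemma underlying_tough (R : realType) (r : R) (t : nat) : 0 < t -> (t%:R <= r)%R ->
  tough G r ->
  nat_tough t underlying.
Proof.
move=> t0 tr toughG S I sIS sepI; have := toughG S.
set om := omega (~: S) setT => hom.
have r0 : (0 < r)%R by apply: lt_le_trans tr; rewrite ltr0n.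
(* [n_comp] counts roots, and the vertices of [I] have distinct ones. *)
have cI : #|I| <= om.
  pose e := adj (~: S) [set: edge G].
  have inj : {in I &, injective (fingraph.root e)}.
    move=> x y xI yI /eqP; rewrite root_connect; last exact: connect_adj_sym.
    move=> cxy; apply: sepI => //; move: cxy;
      apply: connect_sub => u v /and3P[uS vS /exists_inP[f _ /eqP fuv]].
    by apply: conn1; rewrite in_inside set2_subset uS vS !andbT -fuv imset_f.
  rewrite -(card_in_imset inj); apply: subset_leq_card; apply/subsetP=> _ /imsetP[x xI ->].
  rewrite inE /= roots_root; last exact: connect_adj_sym.
  by rewrite -(closed_connect (@closed_adj G (~: S) setT) (connect_root _ x)) (subsetP sIS).
move: hom; rewrite le_max => /orP[h|h]; [left|right].
  by apply: leq_trans cI _; rewrite -(ler_nat R).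
rewrite -(ler_nat R) natrM; apply: (@le_trans _ _ (r * om%:R)%R).
  by apply: ler_pM; rewrite ?ler0n // ler_nat.
by rewrite -ler_pdivlMl.
Qed.

Lemma lift_factor (F : {set {set V}}) (v0 : V) : F \subset underlying -> spans F ->
  exists F' : {set edge G}, connected_factor F' /\ forall v, degree F' v = deg F v.
Proof.
(* Of each class of parallel edges only the one returned by [pick] is kept, so [ends] is injective
   on [F']. *)
move=> sF cF; pose F' := [set e : edge G | (ends e \in F) && ([pick e' | ends e' == ends
  e] == Some e)].
have inj : {in F' &, injective (@ends G)}.
  move=> e e'; rewrite !inE => /andP[_ /eqP h] /andP[_ /eqP h'] E.
  by move: h; rewrite E h' => -[].
have surj f : f \in F -> exists2 e, e \in F' & ends e = f.
  move=> fF; have /imsetP[e _ De] := subsetP sF _ fF.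
  case E: [pick e' | ends e' == ends e] => [e'|]; last first.
    by move: E; case: pickP => // /(_ e); rewrite eqxx.
  have E' : ends e' = ends e by move: E; case: pickP => // x /eqP + [<-].
  by exists e'; rewrite ?E' // inE E' E eqxx -De fF.
exists F'; split; last first.
  move=> v; rewrite /degree /deg -(card_in_imset (f := @ends G)); last first.
    by move=> e e'; rewrite !inE => /andP[h _] /andP[h' _]; apply: inj; rewrite inE.
  apply: eq_card => f; rewrite inE; apply/imsetP/andP => [[e]|[fF vf]].
    by rewrite !inE => /andP[/andP[eF _] ve] ->.
  by have [e eF' De] := surj _ fF; exists e => //; rewrite inE eF' De.
have adjE u v : [set u; v] \in F -> adj setT F' u v.
  by move=> /surj[e eF' De]; rewrite /adj !inE /=; apply/exists_inP; exists e => //;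
    rewrite De.
rewrite /connected_factor /omega -[RHS](n_comp_connect (@connect_adj_sym G setT F') v0).
apply: eq_n_comp_r => v; rewrite inE; apply/esym.
by have := cF v0 v; apply: connect_sub => x y /adjE; apply: connect1.
Qed.

End Transfer.

Theorem corollary6p2 (R : realType) (G : multigraph) (a b : nat)
    (a_gt0 : 0 < a) (b_gt0 : 0 < b)
    (even_abV : ~~ odd (a * b * #|vertex G|))
    (lt_ab : a < b)
    (le_b : (b%:R <= 5^-1 * (6 * a%:R + 1) :> R)%R)
    (toughG : tough G (Num.max (2 * b%:R) (64 * (b%:R - a%:R) ^+ 2) : R)%R)
    (card_V : b + 1 <= #|vertex G|) :
  exists F : {set edge G}, is_factor a b F /\ connected_factor F.
Proof.
(* With a < b this yields a >= 4, and a >= 9 once b - a >= 2. *)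
have le_b' : 5 * b <= 6 * a + 1.
  by move: le_b; rewrite ler_pdivlMl ?ltr0n // -!natrM natr1 ler_nat addn1.
pose t := maxn (2 * b) (64 * (b - a) ^ 2).
have tG : nat_tough t (underlying G).
  apply: underlying_tough toughG; first by rewrite leq_max; lia.
  by rewrite /t natr_max !natrM natrB ?(ltnW lt_ab) // -expr2.
have sG := @underlying_simple G.
have /card_gt0P[v0 _] : 0 < #|vertex G| by lia.
pose c := if odd (a * #|vertex G|) then b else a.
have cab : c = a \/ c = b by rewrite /c; case: ifP; auto.
have ec : ~~ odd (c * #|vertex G|).
  rewrite /c; case: ifP => [|-> //]; move: even_abV; rewrite !oddM.
  by case: (odd a); case: (odd b); case: (odd _).
suff [F [sF cF dF]] : exists F : {set {set vertex G}},
    [/\ F \subset underlying G, spans F & forall v, deg F v = a \/ deg F v = b].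
  have [F' [cF' dF']] := lift_factor v0 sF cF.
  by exists F'; split=> // v; rewrite dF'.
(* Toughness gives nothing on a complete graph; there [card_V] ensures c < |V|. *)
have [/existsP[u /existsP[w /andP[uw nuw]]]|/existsPn complete] :=
    boolP [exists u, exists w, (u != w) && ([set u; w] \notin underlying G)]; last first.
  have [||F [sF cF dF]] := circulant _ _ ec.
  - by case: cab => ->; lia.
  - by case: cab => ->; lia.
  exists F; split=> //; last by move=> v; rewrite dF; case: cab => ->; auto.
  apply/subsetP=> e eF; have [x [y [xy ->]]] := simple_ends sF eF.
  by have /existsPn/(_ y) := complete x; rewrite xy negbK.
have ncG : noncomplete (underlying G) by exists u, w.
have [k1|k2] := leqP (b - a) 1.
  have [||| F [sF cF dF]] := connected_near_factor sG tG ncG (c := b).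
  - by rewrite leq_max (_ : b - a = 1) ?orbT //; lia.
  - exact: leq_maxl.
  - by lia.
  by exists F; split=> // v; have := dF v; lia.
(* This is 64(b - a)^2 with b - a >= 2. *)
have t256 : 256 <= t.
  by rewrite leq_max; apply/orP; right; have := leq_sqr 2 (b - a); rewrite k2; lia.
have [||F [sF cF dF]] := connected_exact_factor sG tG ncG t256 _ _ ec.
- by apply: leq_trans (leq_maxl _ _); rewrite leq_mul2l; case: cab => ->; lia.
- by case: cab => ->; lia.
by exists F; split=> // v; rewrite dF.
Qed.
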